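(* Consider a MIMO fluid antenna system (MIMO-FAS) in which the transmitter and receiver each have a planar fluid antenna surface of finite area $W_{tx}$, resp. $W_{rx}$, and activate $n_{tx}$, resp. $n_{rx}$, of their ports. Then the outer bound (upper bound on the achievable diversity gain) of the diversity-multiplexing tradeoff of MIMO-FAS is the piecewise linear function connecting the point $(n_{\min},0)$ and the points $$\left\{r,\ (N_{rx}'-r)(N_{tx}'-r)\right\},\qquad r=0,\ldots,N',$$ where $n_{\min}=\min\{n_{tx},n_{rx}\}$ and $$N'=\arg\min_{\eta\in\mathbb{Z},\,0\le\eta\le n_{\min}-1}\frac{(N_{rx}'-\eta)(N_{tx}'-\eta)}{n_{\min}-\eta}.$$
   Context: Setting: at side $s\in\{tx,rx\}$, the fluid antenna occupies a rectangle of size $\lambda W_1^s\times\lambda W_2^s$ ($\lambda$ the wavelength, $W_s=\lambda W_1^s\cdot\lambda W_2^s$) containing $N_s=N_1^s N_2^s$ ports on a uniform grid. The spatial correlation between ports $(n_1,n_2)$ and $(\tilde n_1,\tilde n_2)$ is $j_0\!\left(2\pi\sqrt{\left(\frac{|n_1-\tilde n_1|}{N_1^s-1}W_1^s\right)^2+\left(\frac{|n_2-\tilde n_2|}{N_2^s-1}W_2^s\right)^2}\right)$, with $j_0$ the zeroth-order spherical Bessel function of the first kind; these form the $N_s\times N_s$ symmetric matrix $\boldsymbol{J}_s=\boldsymbol{U}_s\boldsymbol{\Lambda}_s\boldsymbol{U}_s^H$ (eigendecomposition, eigenvalues in descending order). The channel is $\boldsymbol{H}=\delta\,\boldsymbol{U}_{rx}\sqrt{\boldsymbol{\Lambda}_{rx}}\boldsymbol{G}\sqrt{\boldsymbol{\Lambda}_{tx}^H}\boldsymbol{U}_{tx}^H$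 with $\boldsymbol{G}$ an $N_{rx}\times N_{tx}$ matrix of i.i.d. circularly symmetric complex Gaussian entries of unit variance and $\delta>0$ constant. $N_s'$ denotes the size of the full-rank symmetric reduced correlation matrix $\boldsymbol{J}^s_{\mathrm{red}}$ obtained from $\boldsymbol{J}_s$ by removing rows/columns that are identical to or linear combinations of others (i.e. $N_s'$ is the rank of $\boldsymbol{J}_s$). A MIMO-FAS scheme chooses $n_{rx}$ distinct receive ports and $n_{tx}$ distinct transmit ports (giving the submatrix $\bar{\boldsymbol{H}}=\boldsymbol{A}_{rx}\boldsymbol{H}\boldsymbol{A}_{tx}$ with $\boldsymbol{A}_s$ port-selection matrices), an input covariance $\boldsymbol{K}$ with $\mathrm{trace}(\boldsymbol{K})\le\mathrm{SNR}$, and achieves rate $\log\det(\boldsymbol{I}+\bar{\boldsymbol{H}}\boldsymbol{K}\bar{\boldsymbol{H}}^H)$ (noise has identity covariance). Diversity-multiplexing tradeoff: a scheme achieves multiplexing gain $r$ and diversity gain $d(r)$ if its rate satisfies $\lim_{\mathrm{SNR}\to\infty}R(\mathrm{SNR})/\log\mathrm{SNR}=r$ and its outage probability $P^{\mathrm{out}}(\mathrm{SNR},r)=\mathbb{P}\{R(\mathrm{SNR})<r\log\mathrm{SNR}\}$ satisfies $\lim_{\mathrm{SNR}\to\infty}\log P^{\mathrm{out}}(\mathrm{SNR},r)/\log\mathrm{SNR}=-d(r)$. *)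

(* Defs.v *)
From HB Require Import structures.
From mathcomp Require Import all_boot all_order all_algebra.
From mathcomp Require Import all_classical all_reals all_analysis.
From mathcomp Require Import complex.
Set Implicit Arguments. Unset Strict Implicit. Unset Printing Implicit Defensive.
Import Order.TTheory GRing.Theory Num.Theory.
Import numFieldNormedType.Exports.
Local Open Scope classical_set_scope.
Local Open Scope ring_scope.
Local Open Scope sesquilinear_scope.
Import ComplexField.
Local Open Scope complex_scope.

Section Defs.
Variable R : realType.
Local Notation C := R[i].

Definition j0 (x : R) : R := if x == 0 then 1 else sin x / x.

Definition port1 (N1 N2 : nat) (i : 'I_(N1 * N2)) : nat := (i %/ N2)%N.
Definition port2 (N1 N2 : nat) (i : 'I_(N1 * N2)) : nat := (i %% N2)%N.

Definition corr_mx (N1 N2 : nat) (W1 W2 : R) : 'M[R]_(N1 * N2) :=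
  \matrix_(i, j) j0 (2 * pi * Num.sqrt (
     ((`|(port1 i)%:R - (port1 j)%:R| / (N1%:R - 1)) * W1) ^+ 2
   + ((`|(port2 i)%:R - (port2 j)%:R| / (N2%:R - 1)) * W2) ^+ 2)).

Definition is_eigendecomp n (J : 'M[R]_n) (U : 'M[C]_n) (lam : 'I_n -> R) : Prop :=
  [/\ U \is unitarymx,
      (forall i j : 'I_n, (i <= j)%N -> lam j <= lam i)
    & map_mx (fun x => x%:C) J = U *m diag_mx (\row_i (lam i)%:C) *m U ^t*].

Definition channel (delta : R) nr nt (Ur : 'M[C]_nr) (lr : 'I_nr -> R)
  (Ut : 'M[C]_nt) (lt : 'I_nt -> R) (G : 'M[C]_(nr, nt)) : 'M[C]_(nr, nt) :=
  delta%:C *: (Ur *m diag_mx (\row_i (Num.sqrt (lr i))%:C) *m G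
     *m (diag_mx (\row_j (Num.sqrt (lt j))%:C)) ^t* *m Ut ^t*).

Definition sel_mx n N (s : 'I_n -> 'I_N) : 'M[C]_(n, N) :=
  \matrix_(i, j) (j == s i)%:R.

Definition rate n m (Hbar : 'M[C]_(n, m)) (K : 'M[C]_m) : R :=
  ln (complex.Re (\det (1%:M + Hbar *m K *m Hbar ^t*))).

Definition input_cov n (snr : R) (K : 'M[C]_n) : Prop :=
  [/\ K ^t* = K, (forall v : 'rV[C]_n, 0 <= (v *m K *m v ^t*) 0 0)
    & \tr K <= snr%:C].

Definition iid_CN d (T : measurableType d) (P : probability T R) m n
    (G : T -> 'M[C]_(m, n)) : Prop :=
  let X := fun (k : 'I_m * 'I_n * bool) w =>
    if k.2 then complex.Re (G w k.1.1 k.1.2) else complex.Im (G w k.1.1 k.1.2) in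
  [/\ (forall k, measurable_fun setT (X k)),
      (forall k (B : set R), measurable B ->
          P (X k @^-1` B) = normal_prob 0 (Num.sqrt (2^-1)) B)
    & (forall B : 'I_m * 'I_n * bool -> set R, (forall k, measurable (B k)) ->
          P (\bigcap_(k in setT) (X k @^-1` B k)) =
          (\prod_(k : 'I_m * 'I_n * bool) P (X k @^-1` B k))%E)].

Definition dpt (a b : nat) (k : R) : R := (a%:R - k) * (b%:R - k).

Definition Nprime_ratio (a b nmin eta : nat) : R :=
  dpt a b eta%:R / (nmin%:R - eta%:R).

Definition is_Nprime (a b nmin Np : nat) : Prop :=
  (Np < nmin)%N /\
  forall eta : nat, (eta < nmin)%N -> Nprime_ratio a b nmin Np <= Nprime_ratio a b nmin eta.

Definition dmt_outer (a b nmin Np : nat) (r : R) : R :=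
  if r <= Np%:R then
    let k : R := (Num.floor r)%:~R in
    (k + 1 - r) * dpt a b k + (r - k) * dpt a b (k + 1)
  else dpt a b Np%:R * (nmin%:R - r) / (nmin%:R - Np%:R).


(* Outage event of a MIMO-FAS scheme at a given SNR and multiplexing gain r:
   the port selections [selr], [selt] and covariance [K] may depend on the SNR
   and on the channel realisation [Hw w]. *)
Definition outage_event d (T : measurableType d) Nr Nt
    (Hw : T -> 'M[C]_(Nr, Nt)) nr nt
    (selr : R -> 'M[C]_(Nr, Nt) -> 'I_nr -> 'I_Nr)
    (selt : R -> 'M[C]_(Nr, Nt) -> 'I_nt -> 'I_Nt)
    (K : R -> 'M[C]_(Nr, Nt) -> 'M[C]_nt) (snr r : R) : set T :=
  [set w | rate (sel_mx (selr snr (Hw w)) *m Hw w *m (sel_mx (selt snr (Hw w)))^T)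
                (K snr (Hw w)) < r * ln snr].

End Defs.

(* Main.v *)
Require Import Defs.
From HB Require Import structures.
From mathcomp Require Import all_boot all_order all_algebra.
From mathcomp Require Import all_classical all_reals all_analysis.
From mathcomp Require Import complex.
From mathcomp Require Import perm measurable_realfun ring lra.
Set Implicit Arguments. Unset Strict Implicit. Unset Printing Implicit Defensive.
Import Order.TTheory GRing.Theory Num.Theory.
Import numFieldNormedType.Exports.
Local Open Scope classical_set_scope.
Local Open Scope ring_scope.

(** The correlation kernel [j0 |x|] is the average of plane waves over the unit sphere of R^3, so
    the correlation matrix of distinct ports is a Gram matrix of linearly independent exponentials.
    Hence it has full rank: N'_s is the number N_s of ports, and n_min <= N'_s.  (If the ranks could
    be smaller than n_min the claimed bound could be negative.)

    To bound the diversity from above it suffices to exhibit a likely enough event on which every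
    scheme is in outage.  Fix exponents alpha_0 <= alpha_1 <= ... in [0, 1], constant from
    n = n_min on, and write scale t = SNR^(-alpha_t / 2).  Consider the matrices
    G = L diag(scale) U + O(scale n) with L, U bounded.

    - Rate.  Then the selected channel is P diag(scale) Q with P, Q bounded, and
      the determinant of 1 + H K H^H expands into products in which every scale occurs at most twice and at most
      n of them occur; this gives rate <= (sum_(t < n) (1 - alpha_t)) log SNR + O(1).
    - Probability.  Parametrising L and U by a triangular factorisation, and letting the parameters
      run through a grid, yields disjoint boxes of side scale n for the Gaussian entries.  The box
      count times the probability of one box is of order prod_(i, j) scale (min i j) ^ 2.

    So d <= sum_(i, j) alpha_(min i j) as soon as sum_(t < n) (1 - alpha_t) < r.  The vertices and
    edges of the claimed piecewise linear function come from
    alpha = (0, ..., 0, x, 1, 1, ...) and from alpha = (0, ..., 0, x, x, ...). *)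

(** * Averages over the unit interval *)

Section Mean.
Variable R : realType.
Implicit Types f g : R -> R.

Definition mean f : R := \int[@lebesgue_measure R]_(x in `[0, 1]) f x.

Lemma integrable_mean f : continuous f ->
  (@lebesgue_measure R).-integrable `[0, 1]%classic (EFin \o f).
Proof.
move=> cf; apply: continuous_compact_integrable; first exact: segment_compact.
exact: continuous_subspaceT.
Qed.

Lemma meanD f g : continuous f -> continuous g ->
  mean (fun x => f x + g x) = mean f + mean g.
Proof. by move=> cf cg; rewrite /mean RintegralD//; exact: integrable_mean. Qed.

Lemma meanB f g : continuous f -> continuous g ->
  mean (fun x => f x - g x) = mean f - mean g.
Proof. by move=> cf cg; rewrite /mean RintegralB//; exact: integrable_mean. Qed.

Lemma meanZ (a : R) f : continuous f -> mean (fun x => a * f x) = a * mean f.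
Proof. by move=> cf; rewrite /mean RintegralZl//; exact: integrable_mean. Qed.

Lemma mean_cst (a : R) : mean (fun=> a) = a.
Proof.
by rewrite /mean Rintegral_cst//= lebesgue_measure_itv/= lte_fin ltr01/= subr0 mulr1.
Qed.

Lemma continuous_sumr (I : Type) (s : seq I) (F : I -> R -> R) :
  (forall i, continuous (F i)) -> continuous (fun x => \sum_(i <- s) F i x).
Proof. by move=> cF x; apply: cvg_big => [|i _]; [exact: add_continuous|exact: cF]. Qed.

Lemma mean_sum (I : Type) (s : seq I) (F : I -> R -> R) :
  (forall i, continuous (F i)) ->
  mean (fun x => \sum_(i <- s) F i x) = \sum_(i <- s) mean (F i).
Proof.
move=> cF; elim: s => [|i s IH].
  by rewrite big_nil -[RHS](mean_cst 0); congr mean; apply/funext => x; rewrite big_nil.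
rewrite big_cons -IH -meanD//; last exact: continuous_sumr.
by congr mean; apply/funext => x; rewrite big_cons.
Qed.

Lemma mean_le f g : continuous f -> continuous g ->
  (forall x, 0 <= x <= 1 -> f x <= g x) -> mean f <= mean g.
Proof.
move=> cf cg fg; apply: le_Rintegral => //; exact: integrable_mean.
Qed.

Lemma mean_dist f g (M : R) : continuous f -> continuous g ->
  (forall x, 0 <= x <= 1 -> `|f x - g x| <= M) -> `|mean f - mean g| <= M.
Proof.
move=> cf cg fg; have cc (a : R) : continuous (fun _ : R => a) by exact: cst_continuous.
have cM : continuous (fun x => g x + M) by move=> x; apply: cvgD; [exact: cg|exact: cc].
have cM' : continuous (fun x => f x + M) by move=> x; apply: cvgD; [exact: cf|exact: cc].
have h1 : mean f <= mean g + M.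
  rewrite -[X in _ + X]mean_cst -meanD//; apply: mean_le => // x /fg; rewrite ler_norml.
  by move=> /andP[]; lra.
have h2 : mean g <= mean f + M.
  rewrite -[X in _ + X]mean_cst -meanD//; apply: mean_le => // x /fg; rewrite ler_norml.
  by move=> /andP[]; lra.
by rewrite ler_norml; lra.
Qed.

Lemma mean_derive F f : (forall x : R, is_derive x 1 F (f x)) -> continuous f ->
  mean f = F 1 - F 0.
Proof.
move=> dF cf; rewrite /mean /Rintegral.
have cF : continuous F.
  by move=> x; apply/differentiable_continuous/derivable1_diffP; have [] := dF x.
rewrite (@continuous_FTC2 _ f F)//.
- exact: continuous_subspaceT.
- split.
  + by move=> x _; have [] := dF x.
  + by apply: cvg_at_right_filter; exact: cF.
  + by apply: cvg_at_left_filter; exact: cF.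
- by move=> x _; rewrite derive1E; apply: derive_val.
Qed.

(** By continuity a positive value at [x] stays above half of itself on a short interval ending at
    [x], which would force a positive mean. *)
Lemma mean_eq0 f : continuous f -> (forall x, 0 <= f x) -> mean f = 0 ->
  forall x, 0 < x < 1 -> f x = 0.
Proof.
move=> cf f0 mf x /andP[x0 x1]; apply/eqP; apply: contraT => fx; exfalso.
have fx0 : 0 < f x by rewrite lt_neqAle eq_sym fx f0.
have := cf x => /cvgrPdist_lt /(_ (f x / 2)); rewrite divr_gt0// => /(_ isT).
case/nbhs_ballP => e /= e0 he.
pose a := Num.max 0 (x - e / 2); pose b := x.
have ab : a < b by rewrite /a /b gt_max x0/=; lra.
have a0 : 0 <= a by rewrite le_max lexx.
have fab y : y \in `[a, b] -> f x / 2 <= f y.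
  rewrite in_itv/= /b => /andP[]; rewrite ge_max => /andP[y0 y1 yx].
  have xye : `|x - y| < e by rewrite ltr_norml; lra.
  by have := he y xye; rewrite /= ltr_norml => /andP[]; lra.
have : f x / 2 * (b - a) <= mean f.
  rewrite /mean.
  have -> : f x / 2 * (b - a) = \int[@lebesgue_measure R]_(x0 in `[a, b]) (f x / 2).
    by rewrite Rintegral_cst//= lebesgue_measure_itv/= lte_fin ab.
  have iab : (@lebesgue_measure R).-integrable `[a, b]%classic (EFin \o f).
    apply: continuous_compact_integrable; first exact: segment_compact.
    exact: continuous_subspaceT.
  apply: (@le_trans _ _ (\int[@lebesgue_measure R]_(x in `[a, b]) f x)).
    apply: le_Rintegral => //.
      apply: continuous_compact_integrable; first exact: segment_compact.
      by apply: continuous_subspaceT; exact: cst_continuous.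
  rewrite /Rintegral fine_le//.
  - exact: integrable_fin_num.
  - by apply: integrable_fin_num => //; exact: integrable_mean.
  - apply: ge0_subset_integral => //=.
    + apply/measurable_EFinP; apply: measurable_funS (continuous_measurable_fun cf) => //.
    + by move=> y _; rewrite lee_fin.
    + by move=> y /=; rewrite !in_itv/= /b => /andP[? ?]; apply/andP; split; lra.
rewrite mf; apply/negP; rewrite -ltNge; apply: mulr_gt0; lra.
Qed.

End Mean.

(** * Taylor bounds for sine and cosine, and Wallis moments *)

Section Sinc.
Variable R : realType.
Implicit Types f g : R -> R.

Lemma is_derive_continuous f df : (forall x : R, is_derive x 1 f (df x)) -> continuous f.
Proof.
by move=> h x; apply/differentiable_continuous/derivable1_diffP; have [] := h x.
Qed.

Lemma is_derive_exprn f n (x df : R) : is_derive x 1 f df ->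
  is_derive x 1 (fun y => f y ^+ n) (n%:R * f x ^+ n.-1 * df).
Proof.
move=> h; have -> : (fun y => f y ^+ n) = f ^+ n by apply/funext => y; rewrite exprfctE.
exact: is_deriveX.
Qed.

Lemma is_derive_expr_fact n (x : R) :
  is_derive x 1 (fun y => y ^+ n.+1 / n.+1`!%:R) (x ^+ n / n`!%:R).
Proof.
have h : is_derive x 1 (fun y : R => n.+1`!%:R^-1 * (y ^+ n.+1))
   (n.+1`!%:R^-1 * (n.+1%:R * x ^+ n * 1)).
  apply: is_deriveZ; exact: (is_derive_exprn _ (is_derive_id x 1)).
have -> : (fun y : R => y ^+ n.+1 / n.+1`!%:R) = (fun y => n.+1`!%:R^-1 * (y ^+ n.+1)).
  by apply/funext => y; rewrite mulrC.
apply: is_derive_eq h _; rewrite factS natrM mulr1.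
have : n`!%:R != 0 :> R by rewrite pnatr_eq0 -lt0n fact_gt0.
have : n.+1%:R != 0 :> R by rewrite pnatr_eq0.
by move=> ? ?; field; rewrite nat1r; apply/andP.
Qed.

(** One integration step of a Taylor estimate: for [s = 1] and [s = -1], [x ^+ n.+1 / n.+1!] plus
    [s * g x] has a nonnegative derivative, so the mean value theorem keeps it nonnegative. *)
Lemma derive_norm_le_expr n g (dg : R -> R) : g 0 = 0 ->
  (forall x : R, is_derive x 1 g (dg x)) ->
  (forall x, 0 <= x -> `|dg x| <= x ^+ n / n`!%:R) ->
  forall x, 0 <= x -> `|g x| <= x ^+ n.+1 / n.+1`!%:R.
Proof.
move=> g0 dgE hg x x0.
suff mono (s : R) : `|s| = 1 -> 0 <= x ^+ n.+1 / n.+1`!%:R + s * g x.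
  by have := mono 1 (normr1 _); have := mono (-1) (normrN1 _); rewrite ler_norml; lra.
move=> s1.
pose h := fun y : R => y ^+ n.+1 / n.+1`!%:R + s * g y.
have dh (y : R) : is_derive y 1 h (y ^+ n / n`!%:R + s * dg y).
  exact: is_deriveD (is_derive_expr_fact n y) (is_deriveZ s (dgE y)).
have [c cx] := @MVT_segment _ h _ 0 x x0 (fun y _ => dh y)
  (continuous_subspaceT (is_derive_continuous dh)).
have h0 : h 0 = 0 by rewrite /h g0 expr0n/= mul0r mulr0 addr0.
rewrite h0 !subr0 /h => ->; apply: mulr_ge0 => //.
have /andP[c0 _] : 0 <= c <= x by move: cx; rewrite in_itv.
have := hg c c0; have : `|s * dg c| = `|dg c| by rewrite normrM s1 mul1r.
by move=> <-; rewrite ler_norml => /andP[]; lra.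
Qed.

Definition cos_sum K (x : R) := \sum_(k < K) (-1) ^+ k * (x ^+ k.*2 / k.*2`!%:R).
Definition sin_sum K (x : R) := \sum_(k < K) (-1) ^+ k * (x ^+ k.*2.+1 / k.*2.+1`!%:R).

Lemma is_derive_sin_sum K (x : R) : is_derive x 1 (sin_sum K) (cos_sum K x).
Proof.
rewrite /sin_sum /cos_sum.
have -> : (fun x : R => \sum_(k < K) (-1) ^+ k * (x ^+ k.*2.+1 / k.*2.+1`!%:R)) =
  \sum_(k < K) (fun x : R => (-1) ^+ k * (x ^+ k.*2.+1 / k.*2.+1`!%:R)).
  by apply/funext => y; rewrite fct_sumE.
by apply: is_derive_sum => k; apply: is_deriveZ; exact: is_derive_expr_fact.
Qed.

Lemma is_derive_cos_sum K (x : R) : is_derive x 1 (cos_sum K.+1) (- sin_sum K x).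
Proof.
rewrite /sin_sum /cos_sum.
have -> : (fun x : R => \sum_(k < K.+1) (-1) ^+ k * (x ^+ k.*2 / k.*2`!%:R)) =
  cst 1 + \sum_(k < K) (fun x : R => (-1) ^+ k.+1 * (x ^+ k.*2.+2 / k.*2.+2`!%:R)).
  apply/funext => y; rewrite big_ord_recl/= fctE fct_sumE.
  by congr (_ + _); rewrite /= expr0 mul1r divr1.
have h := is_derive_sum (fun k : 'I_K => is_deriveZ ((-1) ^+ k.+1) (is_derive_expr_fact k.*2.+1 x)).
have := is_deriveD (is_derive_cst (1 : R) x (1 : R)) h.
move=> {}h; apply: is_derive_eq h _; rewrite add0r -sumrN; apply: eq_bigr => k _.
by rewrite exprS mulN1r /GRing.scale/= mulNr.
Qed.

(** The bounds are integrated alternately: the cosine bound of order [J] gives the sine bound of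
    order [J], which gives the cosine bound of order [J.+1]. The start is [|cos| <= 1]. *)
Lemma cos_sin_taylor_ge0 K (x : R) : 0 <= x ->
  `|cos x - cos_sum K x| <= x ^+ K.*2 / K.*2`!%:R /\
  `|sin x - sin_sum K x| <= x ^+ K.*2.+1 / K.*2.+1`!%:R.
Proof.
have sin_of_cos J : (forall x : R, 0 <= x -> `|cos x - cos_sum J x| <= x ^+ J.*2 / J.*2`!%:R) ->
    forall x : R, 0 <= x -> `|sin x - sin_sum J x| <= x ^+ J.*2.+1 / J.*2.+1`!%:R.
  move=> h; apply: (@derive_norm_le_expr _ (fun x => sin x - sin_sum J x)
    (fun x => cos x - cos_sum J x)) => //.
    rewrite sin0 /sin_sum big1 ?subr0// => k _; by rewrite expr0n/= mul0r mulr0.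
  by move=> y; apply: is_deriveB; exact: is_derive_sin_sum.
suff hc J y : 0 <= y -> `|cos y - cos_sum J y| <= y ^+ J.*2 / J.*2`!%:R.
  by move=> x0; split; [exact: hc|apply: sin_of_cos x0 => y; exact: hc].
elim: J y => [|J IH] y y0.
  by rewrite /cos_sum big_ord0 subr0 expr0 fact0 divr1 cos_max.
move: y y0; apply: (@derive_norm_le_expr _ (fun x => cos x - cos_sum J.+1 x)
    (fun x => - sin x - - sin_sum J x)).
- rewrite cos0 /cos_sum big_ord_recl big1 ?addr0 /= ?expr0 ?mul1r ?fact0 ?divr1 ?invr1 ?subrr// => k _.
  by rewrite expr0n/= mul0r mulr0.
- by move=> y; apply: is_deriveB; exact: is_derive_cos_sum.
- move=> y y0; rewrite -opprD normrN; apply: sin_of_cos => //.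
Qed.

Lemma cos_sum_abs K x : cos_sum K `|x| = cos_sum K x.
Proof.
by apply: eq_bigr => k _; rewrite -muln2 mulnC exprM real_normK ?num_real// -exprM.
Qed.

Lemma cos_abs (x : R) : cos `|x| = cos x.
Proof. by case: (ger0P x) => // _; rewrite cosN. Qed.

Lemma cos_taylor K (x : R) : `|cos x - cos_sum K x| <= `|x| ^+ K.*2 / K.*2`!%:R.
Proof.
by have [] := @cos_sin_taylor_ge0 K `|x| (normr_ge0 _); rewrite cos_abs cos_sum_abs.
Qed.

Lemma cos_lipschitz (x y : R) : `|cos x - cos y| <= `|x - y|.
Proof.
wlog xy : x y / y <= x.
  by move=> h; case: (leP y x) => [/h//|/ltW/h]; rewrite distrC (distrC y).
have [c _ ->] := @MVT_segment _ (@cos R) (fun x => - sin x) y x xy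
  (fun y _ => is_derive_cos y) (continuous_subspaceT (@continuous_cos R)).
rewrite normrM normrN -[leRHS]mul1r ler_wpM2r//; exact: sin_max.
Qed.

(** The Wallis ratios: [wallis k] is (2k-1)!!/(2k)!!, the average of cos^(2k) over a circle, and
    [wallis2 k] is (2k)!!/(2k+1)!!, the integral of (1-z^2)^k over the unit interval. *)
Fixpoint wallis k : R := if k is j.+1 then wallis j * j.*2.+1%:R / j.*2.+2%:R else 1.
Fixpoint wallis2 k : R := if k is j.+1 then wallis2 j * j.*2.+2%:R / j.*2.+3%:R else 1.

(** This product turns the coefficients 1/(2k)! of the cosine into the coefficients 1/(2k+1)! of sin
    r / r. *)
Lemma wallisM k : wallis k * wallis2 k = k.*2.+1%:R^-1.
Proof.
elim: k => [|k IH] /=; first by rewrite mulr1 invr1.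
transitivity (wallis k * wallis2 k * k.*2.+1%:R / k.*2.+3%:R).
  have a0 : k.*2.+2%:R != 0 :> R by rewrite pnatr_eq0.
  have b0 : k.*2.+3%:R != 0 :> R by rewrite pnatr_eq0.
  have aux (w w2 c a b : R) : a != 0 -> b != 0 -> w * c / a * (w2 * a / b) = w * w2 * c / b.
    by move=> *; field; apply/andP.
  exact: aux.
by rewrite IH mulVf ?pnatr_eq0// mul1r doubleS.
Qed.

(** The phase of the wave: the scalar product of [(p, q)] with the unit vector at angle 2 pi x. *)
Definition planewave (p q x : R) := p * cos (pi *+ 2 * x) + q * sin (pi *+ 2 * x).

Lemma is_derive_planewave p q (x : R) :
  is_derive x 1 (planewave p q) (pi *+ 2 * planewave q (- p) x).
Proof.
have d2 (y : R) : is_derive y 1 (fun z : R => pi *+ 2 * z) (pi *+ 2).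
  by have := @is_deriveZ _ _ _ id (pi *+ 2) y 1 1 (is_derive_id _ _); rewrite /GRing.scale /= mulr1.
rewrite /planewave.
have h : is_derive x 1 (fun x => p * cos (pi *+ 2 * x) + q * sin (pi *+ 2 * x))
   (p * (- sin (pi *+ 2 * x) * (pi *+ 2)) + q * (cos (pi *+ 2 * x) * (pi *+ 2))).
  by apply: is_deriveD; apply: is_deriveZ; apply: is_derive1_comp.
by apply: is_derive_eq h _; ring.
Qed.

Lemma continuous_planewave p q : continuous (planewave p q).
Proof. exact: is_derive_continuous (is_derive_planewave p q). Qed.

Lemma continuous_exprn f n : continuous f -> continuous (fun x => f x ^+ n).
Proof.
by move=> cf x; apply: (@continuous_comp _ _ _ f (fun y => y ^+ n)); [exact: cf|exact: exprn_continuous].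
Qed.

(* With [g] the plane wave, the mean of the derivative of [g' * g ^+ k.*2.+1] vanishes, and
   [g' ^+ 2] is a multiple of [p ^+ 2 + q ^+ 2 - g ^+ 2]. *)
Lemma mean_planewaveX p q k :
  mean (fun x => planewave p q x ^+ k.*2) = wallis k * (p ^+ 2 + q ^+ 2) ^+ k.
Proof.
elim: k => [|k IH]; first by rewrite !mulr1 -[RHS]mean_cst; congr mean; apply/funext.
set g := planewave p q; pose dg := planewave q (- p).
have cg : continuous g by exact: continuous_planewave.
pose F := fun x => dg x * g x ^+ k.*2.+1.
pose r2 := p ^+ 2 + q ^+ 2.
pose f x : R := (k.*2.+1%:R * r2 * (pi *+ 2)) * g x ^+ k.*2 - (k.*2.+2%:R * (pi *+ 2)) * g x ^+ k.*2.+2.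
have dF (x : R) : is_derive x 1 F (f x).
  have dgx : is_derive x 1 g _ := is_derive_planewave p q x.
  have ddgx : is_derive x 1 dg _ := is_derive_planewave q (- p) x.
  have h := is_deriveM ddgx (is_derive_exprn k.*2.+1 dgx).
  apply: is_derive_eq h _; rewrite /f /= /GRing.scale/=.
  have E : dg x ^+ 2 = r2 - g x ^+ 2.
    rewrite /dg /g /planewave /r2; set c := cos _; set s := sin _.
    have : c ^+ 2 + s ^+ 2 = 1 by exact: cos2Dsin2.
    move=> E; transitivity ((p ^+ 2 + q ^+ 2) * (c ^+ 2 + s ^+ 2) - (p * c + q * s) ^+ 2).
      by ring.
    by rewrite E mulr1.
  have -> : planewave (- p) (- q) x = - g x by rewrite /g /planewave; ring.
  rewrite -/g -/dg.
  transitivity (k.*2.+1%:R * (pi *+ 2) * dg x ^+ 2 * g x ^+ k.*2 - (pi *+ 2) * g x ^+ k.*2.+2).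
    by rewrite !exprS expr0; ring.
  by rewrite E -[k.*2.+2%:R]natr1 !exprS expr0; ring.
have c1 j : continuous (fun x => g x ^+ j) by exact: continuous_exprn.
have cZ a j : continuous (fun x => a * g x ^+ j).
  by move=> x; apply: cvgM; [exact: cvg_cst|exact: c1].
have cf : continuous f by move=> x; apply: cvgB; exact: cZ.
have := mean_derive dF cf.
rewrite [X in _ = X](_ : _ = 0); last first.
  by rewrite /F /dg /g /planewave !mulr1 !mulr0 cos0 sin0 cos2pi sin2pi subrr.
rewrite /f meanB// !meanZ// IH doubleS => /eqP; rewrite subr_eq0 => /eqP.
have pn : pi *+ 2 != 0 :> R by rewrite mulrn_eq0/= gt_eqF// pi_gt0.
rewrite -/r2 /= => E.
have k2 : k.*2.+2%:R != 0 :> R by rewrite pnatr_eq0.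
apply: (mulfI (mulf_neq0 k2 pn)); rewrite -E exprS.
have aux (w c a x y t : R) : a != 0 -> a * t * (w * c / a * (x * y)) = c * x * t * (w * y).
  by move=> *; field.
by rewrite aux.
Qed.

(** The function [z * (1 - z^2)^(k+1)] vanishes at 0 and 1, so its derivative has mean 0; this is
    the recurrence of [wallis2]. *)
Lemma mean_circleX k : mean (fun z : R => (1 - z ^+ 2) ^+ k) = wallis2 k.
Proof.
elim: k => [|k IH]; first by rewrite -[RHS]mean_cst; congr mean; apply/funext.
pose g : R -> R := fun z => 1 - z ^+ 2.
pose F := fun z : R => z * g z ^+ k.+1.
pose f x : R := k.*2.+3%:R * g x ^+ k.+1 - k.*2.+2%:R * g x ^+ k.
have dg (x : R) : is_derive x 1 g (- (2 * x)).
  have h := is_deriveB (is_derive_cst (1 : R) x (1 : R)) (is_derive_exprn 2 (is_derive_id x 1)).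
  by apply: is_derive_eq h _; rewrite /GRing.scale/=; ring.
have cg : continuous g by exact: is_derive_continuous dg.
have dF (x : R) : is_derive x 1 F (f x).
  have h := is_deriveM (is_derive_id x 1) (is_derive_exprn k.+1 (dg x)).
  apply: is_derive_eq h _; rewrite /f /= /GRing.scale/=.
  have -> : k.*2.+3%:R = k.+1%:R * 2 + 1 :> R by rewrite -natrM natr1 muln2 doubleS.
  have -> : k.*2.+2%:R = k.+1%:R * 2 :> R by rewrite -natrM muln2 doubleS.
  by rewrite exprS /g; ring.
have c1 j : continuous (fun x => g x ^+ j) by exact: continuous_exprn.
have cZ a j : continuous (fun x => a * g x ^+ j).
  by move=> x; apply: cvgM; [exact: cvg_cst|exact: c1].
have cf : continuous f by move=> x; apply: cvgB; exact: cZ.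
have := mean_derive dF cf.
rewrite [X in _ = X](_ : _ = 0); last first.
  by rewrite /F /g mul0r expr1n subrr expr0n/= mulr0 subrr.
rewrite /f meanB// !meanZ// IH => /eqP; rewrite subr_eq0 => /eqP E.
have k2 : k.*2.+3%:R != 0 :> R by rewrite pnatr_eq0.
have aux (w c a : R) : a != 0 -> c * w = a * (w * c / a) by move=> *; field.
by apply: (mulfI k2); rewrite E; exact: aux.
Qed.

End Sinc.

(** * The spherical average of plane waves *)

Section SincRepr.
Variable R : realType.
Implicit Types f g : R -> R.

Lemma norm_planewave (p q x : R) : `|planewave p q x| <= `|p| + `|q|.
Proof.
apply: le_trans (ler_normD _ _) _; rewrite !normrM.
by apply: lerD; rewrite -[leRHS]mulr1 ler_wpM2l// ?cos_max ?sin_max.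
Qed.

Lemma continuous_cosM (y : R) g : continuous g -> continuous (fun x => cos (y * g x)).
Proof.
move=> cg x; apply: (@continuous_comp _ _ _ (fun x => y * g x) (@cos R)).
  by apply: cvgM; [exact: cvg_cst|exact: cg].
exact: continuous_cos.
Qed.

(** Average of the wave over the circle of radius [y], a horizontal section of the sphere. *)
Definition wavemean (p q y : R) := mean (fun x => cos (y * planewave p q x)).

Lemma wavemean_lipschitz p q (y z : R) :
  `|wavemean p q y - wavemean p q z| <= `|y - z| * (`|p| + `|q|).
Proof.
apply: mean_dist; [exact/continuous_cosM/continuous_planewave..|] => x _.
apply: le_trans (cos_lipschitz _ _) _.
by rewrite -mulrBl normrM ler_wpM2l// norm_planewave.
Qed.

Lemma continuous_wavemean p q : continuous (wavemean p q).
Proof.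
move=> y; apply/cvgrPdist_lt => e e0; near=> z.
apply: le_lt_trans (wavemean_lipschitz _ _ _ _) _.
have M0 : 0 < `|p| + `|q| + 1 by rewrite ltr_pwDr// addr_ge0.
apply: (@le_lt_trans _ _ (`|y - z| * (`|p| + `|q| + 1))).
  by rewrite ler_wpM2l// lerDl.
rewrite -ltr_pdivlMr//; near: z.
by apply: cvgr_dist_lt; [exact: cvg_id|rewrite divr_gt0].
Unshelve. all: by end_near. Qed.

(** The truncated cosine series is averaged term by term; its error bound is uniform in the
    angle. *)
Lemma wavemean_taylor p q (y : R) K :
  `|wavemean p q y - \sum_(k < K) (-1) ^+ k * ((y ^+ 2) ^+ k * (wallis R k * (p ^+ 2 + q ^+ 2) ^+ k) / k.*2`!%:R)|
  <= (`|y| * (`|p| + `|q|)) ^+ K.*2 / K.*2`!%:R.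
Proof.
have cg := @continuous_planewave R p q.
have cX j a : continuous (fun x => a * planewave p q x ^+ j).
  by move=> x; apply: cvgM; [exact: cvg_cst|exact: continuous_exprn].
have -> : \sum_(k < K) (-1) ^+ k * ((y ^+ 2) ^+ k * (wallis R k * (p ^+ 2 + q ^+ 2) ^+ k) / k.*2`!%:R) =
  mean (fun x => \sum_(k < K) ((-1) ^+ k * (y ^+ 2) ^+ k / k.*2`!%:R) * planewave p q x ^+ k.*2).
  rewrite mean_sum//; apply: eq_bigr => k _; rewrite meanZ ?mean_planewaveX; last exact: continuous_exprn.
  by ring.
apply: mean_dist; [exact/continuous_cosM|exact: continuous_sumr|] => x _.
have -> : \sum_(k < K) ((-1) ^+ k * (y ^+ 2) ^+ k / k.*2`!%:R) * planewave p q x ^+ k.*2 =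
   cos_sum K (y * planewave p q x).
  apply: eq_bigr => k _; rewrite [(y * planewave _ _ _) ^+ _]exprMn -[(y ^+ 2) ^+ k]exprM mul2n.
  by ring.
apply: le_trans (cos_taylor _ _) _.
rewrite ler_wpM2r ?invr_ge0 ?ler0n// lerXn2r ?nnegrE ?mulr_ge0 ?addr_ge0//.
by rewrite normrM ler_wpM2l// norm_planewave.
Qed.

Lemma continuous_circle : continuous (fun z : R => Num.sqrt (1 - z ^+ 2)).
Proof.
move=> z; apply: (@continuous_comp R R R (fun z : R => (1 - z ^+ 2 : R)) (@Num.sqrt R)).
  by apply: cvgB; [exact: cvg_cst|exact: exprn_continuous].
exact: sqrt_continuous.
Qed.

Lemma sqr_circle (z : R) : 0 <= z <= 1 -> Num.sqrt (1 - z ^+ 2) ^+ 2 = 1 - z ^+ 2.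
Proof. by move=> /andP[z0 z1]; rewrite sqr_sqrtr// subr_ge0 expr_le1. Qed.

Lemma continuous_wavemean_circle p q : continuous (fun z : R => wavemean p q (Num.sqrt (1 - z ^+ 2))).
Proof.
move=> z; apply: (@continuous_comp R R R (fun z : R => Num.sqrt (1 - z ^+ 2)) (wavemean p q)); first exact: continuous_circle.
exact: continuous_wavemean.
Qed.

(** By Archimedes, heights on the unit sphere are uniformly distributed, and the section at height
    [z] has radius sqrt(1 - z^2). The two Wallis factors combine through [wallisM]. *)
Lemma mean_wavemean_taylor p q K :
  `|mean (fun z => wavemean p q (Num.sqrt (1 - z ^+ 2)))
    - \sum_(k < K) (-1) ^+ k * ((p ^+ 2 + q ^+ 2) ^+ k / k.*2.+1`!%:R)|
  <= (`|p| + `|q|) ^+ K.*2 / K.*2`!%:R.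
Proof.
have cg : continuous (fun z : R => 1 - z ^+ 2 : R).
  by move=> z; apply: cvgB; [exact: cvg_cst|exact: exprn_continuous].
have cj j : continuous (fun z : R => (1 - z ^+ 2) ^+ j : R).
  exact: (@continuous_exprn R _ j cg).
have cX j (a : R) : continuous (fun z : R => a * (1 - z ^+ 2) ^+ j).
  by move=> x; apply: cvgM; [exact: cvg_cst|exact: cj].
have -> : \sum_(k < K) (-1) ^+ k * ((p ^+ 2 + q ^+ 2) ^+ k / k.*2.+1`!%:R) =
  mean (fun z => \sum_(k < K) ((-1) ^+ k * (wallis R k * (p ^+ 2 + q ^+ 2) ^+ k) / k.*2`!%:R) * (1 - z ^+ 2) ^+ k).
  rewrite mean_sum//; apply: eq_bigr => k _; rewrite meanZ ?mean_circleX//.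
  rewrite factS natrM invfM -wallisM.
  by ring.
apply: mean_dist; [exact: continuous_wavemean_circle|exact: continuous_sumr|] => z z01.
have := @wavemean_taylor p q (Num.sqrt (1 - z ^+ 2)) K; rewrite sqr_circle//.
rewrite (eq_bigr (fun k : 'I_K => ((-1) ^+ k * (wallis R k * (p ^+ 2 + q ^+ 2) ^+ k) / k.*2`!%:R) * (1 - z ^+ 2) ^+ k)); last first.
  by move=> k _; ring.
move=> h; apply: le_trans h _.
rewrite ler_wpM2r ?invr_ge0 ?ler0n// lerXn2r ?nnegrE ?mulr_ge0 ?addr_ge0//.
rewrite -[leRHS]mul1r ler_wpM2r ?addr_ge0// ger0_norm ?sqrtr_ge0//.
by rewrite -[leRHS]sqrtr1 ler_wsqrtr// gerBl sqr_ge0.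
Qed.

Lemma expr_fact_cvg0 (M e : R) : 0 < e -> \forall n \near \oo, `|M ^+ n / n`!%:R| < e.
Proof.
move=> e0; have /cvgr0Pnorm_lt/(_ _ e0) := @cvg_exp_coeff R M.
by apply: filterS => n.
Qed.

(** Both sides share all Taylor polynomials, with remainders tending to 0. *)
Lemma j0_mean (p q : R) :
  j0 (Num.sqrt (p ^+ 2 + q ^+ 2)) = mean (fun z => wavemean p q (Num.sqrt (1 - z ^+ 2))).
Proof.
set r := Num.sqrt _; set S := mean _; set M := `|p| + `|q|.
have r0 : 0 <= r by rewrite sqrtr_ge0.
have M0 : 0 <= M by rewrite addr_ge0.
have r2 : r ^+ 2 = p ^+ 2 + q ^+ 2 by rewrite sqr_sqrtr// addr_ge0// sqr_ge0.
(* Multiplying by [r] allows a comparison with the sine itself; the value at [r = 0] is treated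
   separately at the end. *)
have H K : `|r * S - sin r| <= r * (M ^+ K.*2 / K.*2`!%:R) + r ^+ K.*2.+1 / K.*2.+1`!%:R.
  have [_ h1] := cos_sin_taylor_ge0 K r0.
  have h2 := mean_wavemean_taylor p q K.
  have E : sin_sum K r = r * \sum_(k < K) (-1) ^+ k * ((p ^+ 2 + q ^+ 2) ^+ k / k.*2.+1`!%:R).
    rewrite mulr_sumr; apply: eq_bigr => k _.
    by rewrite -r2 -exprM mul2n [r ^+ k.*2.+1]exprS; ring.
  rewrite -[X in `|X|](_ : r * S - sin_sum K r - (sin r - sin_sum K r) = _); last by ring.
  apply: le_trans (ler_normB _ _) _; apply: lerD => //.
  by rewrite E -mulrBr normrM ger0_norm// ler_wpM2l.
have E : r * S = sin r.
  apply/eqP; rewrite -subr_eq0 -normr_le0; apply/ler_addgt0Pr => e e0; rewrite add0r.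
  have e20 : 0 < e / (2 * (r + 1)) by rewrite divr_gt0// mulr_gt0// ltr_pwDr.
  have e2 : 0 < e / 2 by rewrite divr_gt0.
  have [N1 _ h1] := expr_fact_cvg0 M e20.
  have [N2 _ h2] := expr_fact_cvg0 r e2.
  pose K := (N1 + N2)%N.
  apply: le_trans (H K) _.
  have hK1 : (N1 <= K.*2)%N by rewrite -addnn /K -addnA leq_addr.
  have hK2 : (N2 <= K.*2.+1)%N by rewrite -addnn /K leqW// -addnA addnCA leq_addr.
  have a1 := h1 _ hK1; have a2 := h2 _ hK2.
  rewrite ger0_norm in a1; last by rewrite divr_ge0 ?exprn_ge0 ?ler0n.
  rewrite ger0_norm in a2; last by rewrite divr_ge0 ?exprn_ge0 ?ler0n.
  have : r * (M ^+ K.*2 / K.*2`!%:R) <= e / 2.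
    apply: (@le_trans _ _ ((r + 1) * (e / (2 * (r + 1))))).
      by apply: ler_pM => //; [rewrite divr_ge0 ?exprn_ge0 ?ler0n|rewrite lerDl|exact: ltW].
    have r1 : r + 1 != 0 by rewrite gt_eqF// ltr_pwDr.
    by rewrite le_eqVlt; apply/orP; left; apply/eqP; field.
  by move=> a3; rewrite [leRHS]splitr; apply: lerD => //; exact: ltW.
rewrite /j0; case: eqVneq => [rE|rn0]; last by rewrite -E mulrAC divff// mul1r.
have /andP[/eqP p0 /eqP q0] : (p == 0) && (q == 0).
  by move: r2; rewrite rE expr0n/= => /esym/eqP; rewrite paddr_eq0 ?sqr_ge0// !sqrf_eq0.
rewrite /S -[LHS]mean_cst; congr mean; apply/funext => z.
rewrite /wavemean -[LHS]mean_cst; congr mean; apply/funext => x.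
by rewrite p0 q0 /planewave !mul0r addr0 mulr0 cos0.
Qed.

End SincRepr.

(** * Full rank of the correlation matrix *)

Section FullRank.
Variable R : realType.

Lemma planewaveB (p q p' q' x : R) :
  planewave (p - p') (q - q') x = planewave p q x - planewave p' q' x.
Proof. by rewrite /planewave; ring. Qed.

(** The form is the squared modulus of the sum of the [c i] times exp(i a_i). *)
Lemma cos_form_sqr n (c a : 'I_n -> R) :
  \sum_i \sum_j c i * c j * cos (a i - a j) =
  (\sum_i c i * cos (a i)) ^+ 2 + (\sum_i c i * sin (a i)) ^+ 2.
Proof.
rewrite !expr2 !big_distrlr/= -big_split/=; apply: eq_bigr => i _.
by rewrite -big_split/=; apply: eq_bigr => j _; rewrite cosB; ring.
Qed.

(** By [j0_mean] and [cos_form_sqr] the form is an iterated average of nonnegative continuous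
    functions. If it is 0, so is the integrand at every interior radius [y] and angle parameter
    [x]. *)
Lemma sinc_form_eq0 n (c p q : 'I_n -> R) :
  \sum_i \sum_j c i * c j * j0 (Num.sqrt ((p i - p j) ^+ 2 + (q i - q j) ^+ 2)) = 0 ->
  forall y x, 0 < y < 1 -> 0 < x < 1 -> \sum_i c i * cos (y * planewave (p i) (q i) x) = 0.
Proof.
move=> J0 y x /andP[y0 y1] x01.
pose D i j y := wavemean (p i - p j) (q i - q j) y.
pose Psi y := \sum_i \sum_j c i * c j * D i j y.
pose F y x := (\sum_i c i * cos (y * planewave (p i) (q i) x)) ^+ 2
   + (\sum_i c i * sin (y * planewave (p i) (q i) x)) ^+ 2.
have cD i j y' : continuous (fun x => cos (y' * planewave (p i - p j) (q i - q j) x)).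
  exact/continuous_cosM/continuous_planewave.
have cZ (a : R) (f : R -> R) : continuous f -> continuous (fun x => a * f x).
  by move=> cf z; apply: cvgM; [exact: cvg_cst|exact: cf].
have PsiE y' : Psi y' = mean (F y').
  rewrite /Psi.
  transitivity (mean (fun x => \sum_i \sum_j c i * c j * cos (y' * planewave (p i - p j) (q i - q j) x))).
    rewrite mean_sum; last by move=> i; apply: continuous_sumr => j; exact: cZ.
    apply: eq_bigr => i _; rewrite mean_sum; last by move=> j; exact: cZ.
    by apply: eq_bigr => j _; rewrite meanZ.
  congr mean; apply/funext => z; rewrite /F -cos_form_sqr.
  by apply: eq_bigr => i _; apply: eq_bigr => j _; rewrite planewaveB mulrBr.
have F0 y' x' : 0 <= F y' x' by rewrite addr_ge0// sqr_ge0.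
have cF y' : continuous (F y').
  have -> : F y' = (fun x => \sum_i \sum_j c i * c j * cos (y' * planewave (p i - p j) (q i - q j) x)).
    apply/funext => z; rewrite /F -cos_form_sqr.
    by apply: eq_bigr => i _; apply: eq_bigr => j _; rewrite planewaveB mulrBr.
  by apply: continuous_sumr => i; apply: continuous_sumr => j; exact: cZ.
have Psi0 y' : 0 <= Psi y'.
  rewrite PsiE -(@mean_cst R 0); apply: mean_le => //; exact: cst_continuous.
have mPsi : mean (fun z => Psi (Num.sqrt (1 - z ^+ 2))) = 0.
  rewrite -J0 /Psi mean_sum; last first.
    by move=> i; apply: continuous_sumr => j; apply: cZ; exact: continuous_wavemean_circle.
  apply: eq_bigr => i _; rewrite mean_sum; last first.
    by move=> j; apply: cZ; exact: continuous_wavemean_circle.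
  apply: eq_bigr => j _; rewrite meanZ; last exact: continuous_wavemean_circle.
  by rewrite j0_mean.
have cPsi : continuous (fun z : R => Psi (Num.sqrt (1 - z ^+ 2))).
  by apply: continuous_sumr => i; apply: continuous_sumr => j; apply: cZ; exact: continuous_wavemean_circle.
have y2 : 0 < 1 - y ^+ 2 by rewrite subr_gt0 expr_lt1// ltW.
(* This is the height whose section of the sphere has radius [y]. *)
have z01 : 0 < Num.sqrt (1 - y ^+ 2) < 1.
  rewrite sqrtr_gt0 y2/= -[ltRHS]sqrtr1 ltr_sqrt//.
  by rewrite gtrBl exprn_gt0.
have := mean_eq0 cPsi (fun z => Psi0 _) mPsi z01.
rewrite sqr_sqrtr ?ltW// opprB addrC subrK sqrtr_sqr gtr0_norm// PsiE => mF.
have /eqP := mean_eq0 (cF y) (F0 y) mF x01.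
by rewrite /F paddr_eq0 ?sqr_ge0// => /andP[]; rewrite sqrf_eq0 => /eqP.
Qed.

(* The moments vanish one after the other: the lowest surviving one would dominate as [y] tends
   to [0]. *)
Lemma cos_moments_eq0 n (c w : 'I_n -> R) :
  (forall y, 0 < y < 1 -> \sum_i c i * cos (y * w i) = 0) ->
  forall k, \sum_i c i * (w i ^+ 2) ^+ k = 0.
Proof.
move=> h k; have [m] := ubnP k; elim: m k => // m IH k km.
set M := \sum_i _.
(* [C] is the coefficient of the Taylor remainder just after order [k]. *)
pose C := \sum_i `|c i| * (`|w i| ^+ k.+1.*2 / k.+1.*2`!%:R).
have C0 : 0 <= C.
  by apply: sumr_ge0 => i _; rewrite mulr_ge0// divr_ge0 ?exprn_ge0 ?ler0n.
have bnd (y : R) : 0 < y < 1 -> `|M| / k.*2`!%:R <= C * y ^+ 2.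
  move=> y01; have /andP[y0 y1] := y01.
  have E : \sum_i c i * cos_sum k.+1 (y * w i) = (-1) ^+ k * (y ^+ k.*2 / k.*2`!%:R) * M.
    rewrite /cos_sum; under eq_bigr do rewrite mulr_sumr.
    rewrite exchange_big/= big_ord_recr/= big1 ?add0r; last first.
      move=> j _.
      transitivity (((-1) ^+ j * (y ^+ j.*2 / j.*2`!%:R)) * \sum_i c i * (w i ^+ 2) ^+ j).
        rewrite mulr_sumr; apply: eq_bigr => i _.
        by rewrite [(y * w i) ^+ _]exprMn -[(w i ^+ 2) ^+ j]exprM mul2n; ring.
      by rewrite IH ?mulr0// (leq_trans (ltn_ord j)).
    rewrite /M mulr_sumr; apply: eq_bigr => i _.
    by rewrite [(y * w i) ^+ _]exprMn -[(w i ^+ 2) ^+ k]exprM mul2n; ring.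
  have : `|\sum_i c i * cos (y * w i) - \sum_i c i * cos_sum k.+1 (y * w i)| <= C * y ^+ k.+1.*2.
    rewrite -sumrB; apply: le_trans (ler_norm_sum _ _ _) _.
    rewrite /C mulr_suml; apply: ler_sum => i _; rewrite -mulrBr normrM -mulrA ler_wpM2l//.
    apply: le_trans (cos_taylor _ _) _.
    rewrite normrM (gtr0_norm y0) exprMn le_eqVlt; apply/orP; left; apply/eqP.
    by ring.
  have yf : 0 <= y ^+ k.*2 / k.*2`!%:R by rewrite divr_ge0 ?exprn_ge0 ?ler0n ?ltW.
  rewrite h// E sub0r normrN normrM normrM normrX normrN1 expr1n mul1r (ger0_norm yf) => bb.
  have yk : 0 < y ^+ k.*2 by rewrite exprn_gt0.
  rewrite -(ler_pM2l yk).
  have -> : y ^+ k.*2 * (`|M| / k.*2`!%:R) = y ^+ k.*2 / k.*2`!%:R * `|M| by ring.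
  apply: le_trans bb _; rewrite doubleS !exprS expr0.
  by rewrite le_eqVlt; apply/orP; left; apply/eqP; ring.
apply/eqP; rewrite -normr_le0.
have : `|M| / k.*2`!%:R <= 0.
  apply/ler_addgt0Pr => e e0; rewrite add0r.
  (* With [y < 1] and [y <= e / (C + 1)], the bound [C * y ^+ 2] is at most [e]. *)
  pose y := Num.min (2^-1) (e / (C + 1)).
  have C1 : 0 < C + 1 by rewrite ltr_pwDr.
  have y0 : 0 < y by rewrite lt_min invr_gt0 ltr0n divr_gt0.
  have yh : y <= 2^-1 by rewrite ge_min lexx.
  have ye : y <= e / (C + 1) by rewrite ge_min lexx orbT.
  have y1 : y < 1 by lra.
  apply: le_trans (bnd y _) _; first by rewrite y0.
  apply: (@le_trans _ _ ((C + 1) * y)).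
    apply: ler_pM => //; first by rewrite exprn_ge0// ltW.
      by rewrite lerDl.
    by rewrite expr2 ger_pMl// ltW.
  by rewrite mulrC -ler_pdivlMr.
by rewrite pmulr_lle0// invr_gt0 ltr0n fact_gt0.
Qed.

(** The moments test [c] against every polynomial; the one vanishing at all nodes except [u i]
    isolates [c i]. *)
Lemma moments_eq0 n (c u : 'I_n -> R) : injective u ->
  (forall k, \sum_i c i * u i ^+ k = 0) -> forall i, c i = 0.
Proof.
move=> ui h i.
have hp (P : {poly R}) : \sum_j c j * P.[u j] = 0.
  under eq_bigr do rewrite horner_coef mulr_sumr.
  rewrite exchange_big big1//= => k _.
  transitivity (P`_k * \sum_j c j * u j ^+ k); last by rewrite h mulr0.
  by rewrite mulr_sumr; apply: eq_bigr => j _; rewrite mulrCA.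
have := hp (\prod_(j | j != i) ('X - (u j)%:P)).
rewrite (bigD1 i)//= [X in _ + X]big1 ?addr0; last first.
  move=> j ji; rewrite horner_prod (bigD1 j)//= hornerXsubC subrr mul0r mulr0//.
move/eqP; rewrite mulf_eq0 => /orP[/eqP//|]; rewrite horner_prod => /prodf_eq0[j ji].
by rewrite hornerXsubC subr_eq0 => /eqP/ui/esym/eqP; rewrite (negbTE ji).
Qed.

(* A direction close to the first axis separates the points. *)
Lemma generic_direction n (p q : 'I_n -> R) :
  (forall i j, p i = p j -> q i = q j -> i = j) ->
  exists x, [/\ 0 < x < 1, 0 < cos (pi *+ 2 * x), 0 < sin (pi *+ 2 * x) &
    injective (fun i => planewave (p i) (q i) x)].
Proof.
move=> pq.
have pi0 := @pi_gt0 R.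
have quarter (x : R) : 0 < x -> x < 4^-1 -> 0 < pi *+ 2 * x < pi / 2.
  have pi2 : 0 < pi *+ 2 :> R by rewrite mulr2n addr_gt0.
  move=> x0 x4; rewrite mulr_gt0//=.
  have : pi * x < pi * 4^-1 by rewrite ltr_pM2l.
  by lra.
(* There are finitely many pairs, so each may be separated for small positive [x]: if the [p]
   differ, the phase difference tends to their nonzero difference at 0; otherwise the [q] differ and
   the sine is positive. *)
have H : \forall x \near (0 : R)^'+, forall ij : 'I_n * 'I_n, ij.1 != ij.2 ->
    planewave (p ij.1) (q ij.1) x != planewave (p ij.2) (q ij.2) x.
  apply: filter_forall => -[i j] /=.
  have [->|ij] := eqVneq i j; first exact: nearW.
  have [pe|pe] := eqVneq (p i) (p j).
    have qe : q i != q j by apply: contra ij => /eqP qe; apply/eqP; exact: pq.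
    near=> t; move=> _; rewrite -subr_eq0 -planewaveB pe subrr /planewave mul0r add0r.
    rewrite mulf_neq0 ?subr_eq0// gt_eqF// sin_gt0_pihalf//; apply: quarter; near: t.
      exact: nbhs_right_gt.
    by apply: nbhs_right_lt; rewrite invr_gt0.
  have : planewave (p i - p j) (q i - q j) x @[x --> (0:R)^'+] --> p i - p j.
    apply: cvg_at_right_filter.
    have := @continuous_planewave R (p i - p j) (q i - q j) 0.
    by rewrite /continuous_at {2}/planewave mulr0 cos0 sin0 mulr1 mulr0 addr0.
  move/cvgr_neq0 => /(_ _); rewrite subr_eq0 => /(_ pe).
  by apply: filterS => x; rewrite planewaveB subr_eq0.
near (0 : R)^'+ => x.
have Hx : forall ij : 'I_n * 'I_n, ij.1 != ij.2 ->
    planewave (p ij.1) (q ij.1) x != planewave (p ij.2) (q ij.2) x by near: x.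
have x0 : 0 < x by [].
have x4 : x < 4^-1 by near: x; apply: nbhs_right_lt; rewrite invr_gt0.
exists x; split.
- by rewrite x0/=; lra.
- by apply: cos_gt0_pihalf; have := quarter x x0 x4; lra.
- exact/sin_gt0_pihalf/quarter.
- move=> i j /= e; apply/eqP; apply: contraT => ij.
  suff : planewave (p i) (q i) x != planewave (p j) (q j) x by rewrite e eqxx.
  exact: (Hx (i, j)).
Unshelve. all: by end_near. Qed.

(** A kernel vector annihilates the form of [sinc_form_eq0], so its moments against the squared
    phases vanish. In a generic direction the phases are nonnegative and distinct, hence their
    squares are distinct and the vector is 0. *)
Lemma rank_corr_mx N1 N2 (W1 W2 : R) : 0 < W1 -> 0 < W2 ->
  \rank (corr_mx N1 N2 W1 W2) = (N1 * N2)%N.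
Proof.
move=> W10 W20; apply/eqP; rewrite -/(row_free _); apply: inj_row_free => v vJ.
pose p i : R := 2 * pi * ((@port1 N1 N2 i)%:R / (N1%:R - 1) * W1).
pose q i : R := 2 * pi * ((@port2 N1 N2 i)%:R / (N2%:R - 1) * W2).
have pi0 := @pi_gt0 R.
have JE i j : corr_mx N1 N2 W1 W2 i j = j0 (Num.sqrt ((p i - p j) ^+ 2 + (q i - q j) ^+ 2)).
  rewrite mxE; congr j0.
  rewrite -{1}[2 * pi]gtr0_norm ?mulr_gt0// -sqrtr_sqr -sqrtrM ?sqr_ge0//; congr Num.sqrt.
  rewrite !exprMn !real_normK ?num_real// /p /q; ring.
have N12 (i : 'I_(N1 * N2)) : (0 < N1)%N && (0 < N2)%N.
  by rewrite -muln_gt0 (leq_ltn_trans _ (ltn_ord i)).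
have ppos i : 0 <= p i.
  have /andP[h _] := N12 i.
  by rewrite !mulr_ge0 ?(ltW pi0) ?(ltW W10)// invr_ge0 subr_ge0 ler1n.
have qpos i : 0 <= q i.
  have /andP[_ h] := N12 i.
  by rewrite !mulr_ge0 ?(ltW pi0) ?(ltW W20)// invr_ge0 subr_ge0 ler1n.
have pq i j : p i = p j -> q i = q j -> i = j.
  have pn : 2 * pi != 0 :> R by rewrite gt_eqF// mulr_gt0.
  move=> /(mulfI pn) /(mulIf (lt0r_neq0 W10)) pe /(mulfI pn) /(mulIf (lt0r_neq0 W20)) qe.
  have e1 : port1 i = port1 j.
    (* For [N1 = 1] the divisor [N1 - 1] is 0, but then the first index of every port is 0. *)
    have [N1E|N1E] := eqVneq N1 1%N.
      have hp (k : 'I_(N1 * N2)) : port1 k = 0%N.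
        by rewrite /port1 divn_small//; have := ltn_ord k; rewrite [X in (_ < X * _)%N]N1E mul1n.
      by rewrite !hp.
    apply/eqP; rewrite -(eqr_nat R); apply/eqP; apply: mulIf pe.
    by rewrite invr_eq0 subr_eq0 pnatr_eq1.
  have e2 : port2 i = port2 j.
    have [N2E|N2E] := eqVneq N2 1%N.
      have hp (k : 'I_(N1 * N2)) : port2 k = 0%N.
        apply/eqP; rewrite -leqn0 -ltnS -[X in (_ < X)%N]N2E ltn_mod N2E//.
      by rewrite !hp.
    apply/eqP; rewrite -(eqr_nat R); apply/eqP; apply: mulIf qe.
    by rewrite invr_eq0 subr_eq0 pnatr_eq1.
  by apply: val_inj; rewrite /= (divn_eq i N2) (divn_eq j N2); congr (_ * _ + _)%N.
have [x [x01 cx sx inj]] := generic_direction pq.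
have form0 : \sum_i \sum_j v 0 i * v 0 j * j0 (Num.sqrt ((p i - p j) ^+ 2 + (q i - q j) ^+ 2)) = 0.
  rewrite exchange_big/= big1// => j _.
  transitivity ((v *m corr_mx N1 N2 W1 W2) 0 j * v 0 j); last by rewrite vJ mxE mul0r.
  by rewrite mxE mulr_suml; apply: eq_bigr => i _; rewrite JE mulrAC.
have h := sinc_form_eq0 form0.
have wpos i : 0 <= planewave (p i) (q i) x.
  by rewrite addr_ge0// mulr_ge0// ltW.
have c0 := @moments_eq0 _ (fun i => v 0 i) (fun i => planewave (p i) (q i) x ^+ 2) _
  (cos_moments_eq0 (fun y y01 => h y x y01 x01)).
apply/rowP => i; rewrite mxE; apply: c0 => a b /= /eqP.
by rewrite eqrXn2// => /eqP/inj.
Qed.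

End FullRank.

(** * Determinant bounds *)

Section DetExpansion.
Variable F : comNzRingType.

(** Cauchy-Binet before grouping: by multilinearity each row of the product picks one row [f i] of
    [Y]. *)
Lemma det_mulmx_rows n p (X : 'M[F]_(n, p)) (Y : 'M[F]_(p, n)) :
  \det (X *m Y) = \sum_(f : {ffun 'I_n -> 'I_p}) (\prod_i X i (f i)) * \det (rowsub f Y).
Proof.
transitivity (\sum_(s : 'S_n) (-1) ^+ s * \sum_(f : {ffun 'I_n -> 'I_p}) \prod_i (X i (f i) * Y (f i) (s i))).
  apply: eq_bigr => s _; congr (_ * _).
  rewrite -(bigA_distr_bigA (fun i j => X i j * Y j (s i))).
  by apply: eq_bigr => i _; rewrite mxE.
under eq_bigr do rewrite mulr_sumr.
rewrite exchange_big/=; apply: eq_bigr => f _.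
rewrite mulr_sumr; apply: eq_bigr => s _.
by rewrite big_split/= mulrCA; congr (_ * (_ * _)); apply: eq_bigr => i _; rewrite mxE.
Qed.

Lemma det_rowsub_noninj n p (Y : 'M[F]_(p, n)) (f : {ffun 'I_n -> 'I_p}) :
  ~~ injectiveb f -> \det (rowsub f Y) = 0.
Proof.
move=> /injectivePn[i [j ij fij]].
by apply: (determinant_alternate ij) => k; rewrite !mxE fij.
Qed.

(** Sylvester's identity: one block matrix is reduced to triangular form by the same unipotent
    factor, once on the right and once on the left. *)
Lemma det_add1_mulC n m (A : 'M[F]_(n, m)) (B : 'M[F]_(m, n)) :
  \det (1%:M + A *m B) = \det (1%:M + B *m A).
Proof.
pose M := block_mx 1%:M (- A) B 1%:M.
have E1 : M *m block_mx 1%:M A 0 1%:M = block_mx 1%:M 0 B (1%:M + B *m A).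
  by rewrite mulmx_block !mul1mx !mulmx1 !mulmx0 !addr0 subrr (addrC (B *m A)).
have E2 : block_mx 1%:M A 0 1%:M *m M = block_mx (1%:M + A *m B) 0 B 1%:M.
  by rewrite mulmx_block !mul1mx !mulmx1 !mul0mx !add0r addNr.
have d1 : \det (block_mx 1%:M A 0 1%:M) = 1 :> F by rewrite det_ublock !det1 mulr1.
have := congr1 determinant E1; rewrite det_mulmx d1 mulr1 det_lblock det1 mul1r => <-.
by have := congr1 determinant E2; rewrite det_mulmx d1 mul1r det_lblock det1 mulr1 => <-.
Qed.

End DetExpansion.

Section DetBound.
Variable F : numDomainType.

Definition mxbounded m n (B : F) (A : 'M[F]_(m, n)) := forall i j, `|A i j| <= B.

Lemma mxbounded_le m n B C (A : 'M[F]_(m, n)) : B <= C -> mxbounded B A -> mxbounded C A.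
Proof. by move=> BC h i j; apply: le_trans BC. Qed.

Lemma mxbounded_mul m n p B C (X : 'M[F]_(m, n)) (Y : 'M[F]_(n, p)) :
  mxbounded B X -> mxbounded C Y -> mxbounded (n%:R * (B * C)) (X *m Y).
Proof.
move=> hX hY i j; rewrite mxE; apply: le_trans (ler_norm_sum _ _ _) _.
apply: (@le_trans _ _ (\sum_(k < n) B * C)).
  by apply: ler_sum => k _; rewrite normrM ler_pM.
by rewrite sumr_const card_ord mulr_natl.
Qed.

Lemma norm_det_le n B (A : 'M[F]_n) : mxbounded B A -> `|\det A| <= n`!%:R * B ^+ n.
Proof.
move=> h; apply: le_trans (ler_norm_sum _ _ _) _.
apply: (@le_trans _ _ (\sum_(s : 'S_n) B ^+ n)).
  apply: ler_sum => s _; rewrite normrM normrX normrN1 expr1n mul1r normr_prod.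
  apply: (@le_trans _ _ (\prod_(i < n) B)); first by apply: ler_prod => i _; rewrite normr_ge0 h.
  by rewrite prodr_const card_ord.
by rewrite sumr_const card_Sn mulr_natl.
Qed.

(* Only injective [f] contribute to the expansion, so each scale [e t] is used at most once. *)
Lemma norm_det_scaled_le n p B S (T : F) (x : 'M[F]_(n, p)) (e : 'rV[F]_p) (Y : 'M[F]_(p, n)) :
  0 <= B -> 0 <= S -> (forall t, 0 <= e 0 t) -> mxbounded B x ->
  (forall f : {ffun 'I_n -> 'I_p}, injective f -> \prod_i e 0 (f i) <= T) ->
  (forall f : {ffun 'I_n -> 'I_p}, `|\det (rowsub f Y)| <= S) ->
  0 <= T ->
  `|\det (x *m diag_mx e *m Y)| <= (p ^ n)%:R * B ^+ n * T * S.
Proof.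
move=> B0 S0 e0 hx hT hS T0; rewrite det_mulmx_rows; apply: le_trans (ler_norm_sum _ _ _) _.
apply: (@le_trans _ _ (\sum_(f : {ffun 'I_n -> 'I_p}) B ^+ n * T * S)); last first.
  by rewrite sumr_const card_ffun !card_ord -!mulrA mulr_natl.
apply: ler_sum => f _; rewrite normrM.
have [/injectiveP fi|fi] := boolP (injectiveb f); last first.
  by rewrite (det_rowsub_noninj _ fi) normr0 mulr0 !mulr_ge0 ?exprn_ge0.
apply: ler_pM => //; rewrite normr_prod.
under eq_bigr do rewrite mul_mx_diag mxE normrM.
rewrite big_split/=; apply: ler_pM.
- by apply: prodr_ge0.
- by apply: prodr_ge0.
- apply: (@le_trans _ _ (\prod_(i < n) B)); last by rewrite prodr_const card_ord.
  by apply: ler_prod => i _; rewrite normr_ge0 hx.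
- by under eq_bigr do rewrite ger0_norm//; exact: hT.
Qed.

(** The expansion is applied twice: the minors left by the first diagonal factor contain the second
    one. Each application contributes one factor [T]. *)
Lemma norm_det_sandwich_le n p B (T : F) (x : 'M[F]_(n, p)) (e : 'rV[F]_p) (M : 'M[F]_p)
    (z : 'M[F]_(p, n)) :
  0 <= B -> (forall t, 0 <= e 0 t) -> mxbounded B x -> mxbounded B M -> mxbounded B z ->
  (forall f : {ffun 'I_n -> 'I_p}, injective f -> \prod_i e 0 (f i) <= T) -> 0 <= T ->
  `|\det (x *m diag_mx e *m (M *m diag_mx e *m z))|
    <= ((p ^ n) ^ 2 * n`!)%:R * B ^+ (3 * n) * T ^+ 2.
Proof.
move=> B0 e0 hx hM hz hT T0.
pose S := (p ^ n)%:R * B ^+ n * T * (n`!%:R * B ^+ n).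
have S0 : 0 <= S by rewrite /S !mulr_ge0 ?exprn_ge0.
apply: le_trans (norm_det_scaled_le B0 S0 e0 hx hT _ T0) _; last first.
  rewrite le_eqVlt; apply/orP; left; apply/eqP; rewrite /S natrM -mulnn natrM.
  by rewrite !mulSn mul0n addn0 !exprD !expr2; ring.
move=> f; have -> : rowsub f (M *m diag_mx e *m z) = rowsub f M *m diag_mx e *m z.
  by rewrite -!mul_rowsub_mx.
apply: norm_det_scaled_le => //.
- by rewrite mulr_ge0 ?exprn_ge0.
- by move=> i j; rewrite mxE.
- by move=> g; apply: norm_det_le => i j; rewrite mxE.
Qed.

(** By injectivity each [u t] occurs at most once, and the missing ones are at least 1. *)
Lemma prod_inj_le n p (s : F) (e u : 'I_p -> F) (f : 'I_n -> 'I_p) : injective f ->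
  0 <= s -> (forall t, 0 <= e t <= s * u t) -> (forall t, 1 <= u t) ->
  \prod_i e (f i) <= s ^+ n * \prod_t u t.
Proof.
move=> fi s0 he hu.
apply: (@le_trans _ _ (\prod_i (s * u (f i)))); first exact: ler_prod.
rewrite big_split/= prodr_const card_ord ler_wpM2l ?exprn_ge0//.
rewrite -(big_imset (fun t => u t)) /=; last by move=> ? ? _ _; exact: fi.
rewrite [leRHS](bigID (mem (f @: 'I_n)))/= ler_peMr//.
  by apply: prodr_ge0 => t _; apply: le_trans (hu t).
by elim/big_ind: _ => // a b a1 b1; rewrite -[1]mulr1 ler_pM.
Qed.

Lemma norm_det_add1_le n m B (A : 'M[F]_(n, m)) (e : 'rV[F]_m) (N : 'M[F]_m)
    (Z : 'M[F]_(m, n)) (s : F) (u : 'rV[F]_m) :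
  1 <= B -> mxbounded B A -> mxbounded B N -> mxbounded B Z ->
  1 <= s -> (forall t, 0 <= e 0 t <= s * u 0 t) -> (forall t, 1 <= u 0 t) ->
  `|\det (1%:M + A *m diag_mx e *m (N *m diag_mx e *m Z))|
    <= (((n + m) ^ n) ^ 2 * n`!)%:R * B ^+ (3 * n) * (s ^+ n * \prod_t u 0 t) ^+ 2.
Proof.
move=> B1 hA hN hZ s1 he hu.
have B0 : 0 <= B by apply: le_trans B1.
have s0 : 0 <= s by apply: le_trans s1.
pose E : 'rV[F]_(n + m) := row_mx (const_mx 1) e.
pose U : 'rV[F]_(n + m) := row_mx (const_mx 1) u.
(* The identity is absorbed as [n] additional scales equal to 1, which makes the matrix a single
   sandwich. *)
have -> : 1%:M + A *m diag_mx e *m (N *m diag_mx e *m Z) =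
  row_mx 1%:M A *m diag_mx E *m (block_mx 1%:M 0 0 N *m diag_mx E *m col_mx 1%:M Z).
  rewrite diag_mx_row mul_row_block !mulmx0 !addr0 !add0r mulmx_block !mulmx0 !mul0mx !addr0 !add0r.
  rewrite mul_block_col !mul0mx addr0 add0r mul_row_col.
  by rewrite !diag_const_mx ?mul1mx ?mulmx1.
have -> : \prod_t u 0 t = \prod_t U 0 t.
  rewrite big_split_ord/= [X in _ = X * _]big1 ?mul1r; last by move=> i _; rewrite row_mxEl mxE.
  by apply: eq_bigr => i _; rewrite row_mxEr.
have hE t : 0 <= E 0 t <= s * U 0 t.
  by rewrite -[t]fintype.splitK; case: (fintype.split t) => j /=; rewrite ?row_mxEl ?row_mxEr ?mxE ?mulr1 ?ler01.
have hU t : 1 <= U 0 t.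
  by rewrite -[t]fintype.splitK; case: (fintype.split t) => j /=; rewrite ?row_mxEl ?row_mxEr ?mxE.
have b1 k (i j : 'I_k) : `|(1%:M : 'M[F]_k) i j| <= B.
  by rewrite mxE; case: (_ == _); rewrite ?normr1 ?normr0.
apply: norm_det_sandwich_le => //.
- by move=> t; case/andP: (hE t).
- by move=> i t; rewrite -[t]fintype.splitK; case: (fintype.split t) => j /=; rewrite ?row_mxEl ?row_mxEr.
- move=> k j; rewrite -[k]fintype.splitK -[j]fintype.splitK.
  case: (fintype.split k) => a; case: (fintype.split j) => b /=;
    rewrite ?(block_mxEul, block_mxEur, block_mxEdl, block_mxEdr)//; by rewrite mxE normr0.
- by move=> t i; rewrite -[t]fintype.splitK; case: (fintype.split t) => j /=; rewrite ?col_mxEu ?col_mxEd.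
- by move=> f fi; apply: prod_inj_le.
- by rewrite mulr_ge0 ?exprn_ge0// prodr_ge0// => t _; apply: le_trans (hU t).
Qed.

End DetBound.

(** * Upper bounds on capacity determinants *)

Section Capacity.
Local Open Scope sesquilinear_scope.
Variable C : numClosedFieldType.

Lemma trmxC_mul m n p (A : 'M[C]_(m, n)) (B : 'M[C]_(n, p)) : (A *m B) ^t* = B ^t* *m A ^t*.
Proof. by rewrite trmx_mul map_mxM. Qed.

Lemma mxbounded_trC m n B (A : 'M[C]_(m, n)) : mxbounded B A -> mxbounded B (A ^t*).
Proof. by move=> h i j; rewrite !mxE norm_conjC. Qed.

(** Testing the form on a combination of two basis vectors gives [2 |K i j| <= K i i + K j j], and
    each diagonal entry is at most the trace. *)
Lemma psd_entry_le n (K : 'M[C]_n) (s : C) : K ^t* = K ->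
  (forall v : 'rV[C]_n, 0 <= (v *m K *m v ^t*) 0 0) -> \tr K <= s -> mxbounded s K.
Proof.
move=> Kh Kp Kt i j.
pose vv i' j' (x : C) : 'rV[C]_n := delta_mx 0 i' + x *: delta_mx 0 j'.
have formE i' j' (x : C) : (vv i' j' x *m K *m (vv i' j' x) ^t*) 0 0 =
    K i' i' + x^* * K i' j' + x * (K j' i' + x^* * K j' j').
  have E (w : 'rV[C]_n) k : (w *m (delta_mx 0 k : 'rV_n) ^t*) 0 0 = w 0 k.
    rewrite mxE (bigD1 k)//= !mxE !eqxx/= rmorph1 mulr1 big1 ?addr0// => l lk.
    by rewrite !mxE (negbTE lk) andbF rmorph0 mulr0.
  have -> : (vv i' j' x) ^t* =
      (delta_mx 0 i' : 'rV_n) ^t* + x^* *: (delta_mx 0 j' : 'rV_n) ^t*.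
    by apply/matrixP => a b; rewrite !mxE rmorphD rmorphM.
  rewrite mulmxDr -scalemxAr [LHS]mxE [X in _ + X]mxE !E /vv.
  by rewrite !mulmxDl -!scalemxAl -!rowE !mxE; ring.
have Kd k : 0 <= K k k.
  by have := Kp (vv k k 0); rewrite formE rmorph0 !mul0r !addr0.
have Ks k : K k k <= s.
  apply: le_trans Kt; rewrite /mxtrace (bigD1 k)//= lerDl sumr_ge0//.
have [->|Kij] := eqVneq (K i j) 0; first by rewrite normr0 (le_trans (Kd i)).
have nK : `|K i j| != 0 by rewrite normr_eq0.
have Kji : K j i = (K i j)^* by rewrite -{1}Kh !mxE.
(* This unit phase makes both cross terms equal to [- |K i j|]. *)
pose x := - (K i j / `|K i j|).
have cx : x^* = - ((K i j)^* / `|K i j|) by rewrite rmorphN rmorphM fmorphV /= (conj_normC (K i j)).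
have e1 : x^* * K i j = - `|K i j|.
  by rewrite cx mulNr mulrAC [_^* * _]mulrC -normCK expr2 mulfK.
have e2 : x * K j i = - `|K i j|.
  by rewrite Kji /x mulNr mulrAC -normCK expr2 mulfK.
have e3 : x * x^* = 1.
  rewrite /x cx mulrNN mulrACA -normCK -invfM -expr2 divff// sqrf_eq0//.
have := Kp (vv i j x).
rewrite formE mulrDr mulrA e3 mul1r e1 e2 => h.
have : `|K i j| *+ 2 <= s *+ 2.
  rewrite -subr_ge0; apply: le_trans h _; rewrite -subr_ge0.
  have -> : s *+ 2 - `|K i j| *+ 2 - (K i i - `|K i j| + (- `|K i j| + K j j)) =
    (s - K i i) + (s - K j j) by ring.
  by rewrite addr_ge0// subr_ge0.
by rewrite lerMn2r.
Qed.

(** One generous entry bound for every factor of the sandwich: each is a product with at most two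
    factors bounded by [B], and its sums have at most [(nr + nt).+1 ^ 2] terms. *)
Definition cap_bound (nr nt : nat) (B : C) : C := ((nr + nt).+1 ^ 2)%:R * B ^+ 2.

Definition cap_const (nr nt m : nat) (B : C) : C :=
  (((minn nr nt + m) ^ minn nr nt) ^ 2 * (minn nr nt)`!)%:R *
    cap_bound nr nt B ^+ (3 * minn nr nt).

Lemma le_cap_bound nr nt (B : C) k j : (k <= (nr + nt).+1 ^ 2)%N -> (j <= 2)%N -> 1 <= B ->
  k%:R * B ^+ j <= cap_bound nr nt B.
Proof.
move=> hk hj B1; apply: ler_pM; rewrite ?ler0n ?exprn_ge0 ?ler_nat//.
  exact: le_trans B1.
exact: ler_weXn2l.
Qed.

Lemma norm_det_capacity_le nr nt m (B : C) (P : 'M[C]_(nr, m)) (Q : 'M[C]_(m, nt))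
    (d u : 'rV[C]_m) (K : 'M[C]_nt) (rho s : C) :
  1 <= B -> mxbounded B P -> mxbounded B Q -> 0 < rho -> mxbounded (rho ^+ 2) K ->
  (forall t, 0 <= d 0 t) -> (forall t, rho * d 0 t <= s * u 0 t) -> 1 <= s ->
  (forall t, 1 <= u 0 t) ->
  `|\det (1%:M + (P *m diag_mx d *m Q) *m K *m (P *m diag_mx d *m Q) ^t*)|
    <= cap_const nr nt m B * (s ^+ minn nr nt * \prod_t u 0 t) ^+ 2.
Proof.
move=> B1 hP hQ rho0 hK d0 du s1 u1.
have B0 : 0 <= B by apply: le_trans B1.
(* The power [rho ^+ 2] of [K] is shared between the two diagonal factors, which leaves [K'] with
   entries of modulus at most 1. *)
pose e := rho *: d.
have rn : rho != 0 by rewrite gt_eqF.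
have [K' KE hK'] : exists2 K', K = rho ^+ 2 *: K' & mxbounded 1 K'.
  exists ((rho ^+ 2)^-1 *: K); first by rewrite scalerA divff ?scale1r// expf_neq0.
  move=> i j; rewrite mxE normrM normfV (ger0_norm (exprn_ge0 2 (ltW rho0))).
  by rewrite ler_pdivrMl ?exprn_gt0// mulr1.
have dE : (diag_mx d) ^t* = diag_mx d.
  rewrite tr_diag_mx; apply/matrixP => i j; rewrite !mxE rmorphMn /=; congr (_ *+ _).
  by apply/CrealP; rewrite ger0_real.
have eE : diag_mx e = rho *: diag_mx d.
  by apply/matrixP => i j; rewrite !mxE mulrnAr.
have he t : 0 <= e 0 t <= s * u 0 t by rewrite mxE du mulr_ge0// ltW.
set Bb := cap_bound nr nt B.
have bb (k j : nat) (h1 : (k <= (nr + nt).+1 ^ 2)%N) (h2 : (j <= 2)%N) : k%:R * B ^+ j <= Bb.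
  exact: le_cap_bound.
have Bb1 : 1 <= Bb by have := @bb 1%N 0%N; rewrite expr0 mulr1; apply; rewrite ?expn_gt0.
have BBb : B <= Bb by have := @bb 1%N 1%N; rewrite expr1 mul1r; apply; rewrite ?expn_gt0.
have hPb := mxbounded_le BBb hP; have hQb := mxbounded_le BBb hQ.
have [nrt|nrt] := leqP nr nt.
  have -> : (P *m diag_mx d *m Q) *m K *m (P *m diag_mx d *m Q) ^t* =
      P *m diag_mx e *m ((Q *m K' *m Q ^t*) *m diag_mx e *m P ^t*).
    rewrite !trmxC_mul dE eE KE !(=^~ scalemxAr, =^~ scalemxAl) scalerA -expr2.
    by rewrite !mulmxA.
  rewrite /cap_const (minn_idPl nrt); apply: norm_det_add1_le => //.
  - apply: mxbounded_le (mxbounded_mul (mxbounded_mul hQ hK') (mxbounded_trC hQ)).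
    rewrite mulr1 mulrA mulrA -natrM -mulrA -expr2; apply: bb => //.
    by rewrite -mulnn leq_mul// leqW// leq_addl.
  - exact: mxbounded_trC.
(* For [nt < nr] the determinant is moved to size [nt], so that the exponent of [s] is the smaller
   dimension. *)
rewrite -mulmxA det_add1_mulC.
have -> : K *m (P *m diag_mx d *m Q) ^t* *m (P *m diag_mx d *m Q) =
    (K' *m Q ^t*) *m diag_mx e *m ((P ^t* *m P) *m diag_mx e *m Q).
  rewrite !trmxC_mul dE eE KE !(=^~ scalemxAr, =^~ scalemxAl) scalerA -expr2.
  by rewrite !mulmxA.
rewrite /cap_const (minn_idPr (ltnW nrt)); apply: norm_det_add1_le => //.
- apply: mxbounded_le (mxbounded_mul hK' (mxbounded_trC hQ)).
  rewrite mul1r -[X in _ * X]expr1; apply: bb => //.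
  by apply: (@leq_trans (nr + nt).+1); [rewrite leqW// leq_addl|rewrite -mulnn leq_pmulr].
- apply: mxbounded_le (mxbounded_mul (mxbounded_trC hP) hP).
  rewrite -expr2; apply: bb => //.
  by apply: (@leq_trans (nr + nt).+1); [rewrite leqW// leq_addr|rewrite -mulnn leq_pmulr].
Qed.

End Capacity.

(** * Lower bound on capacity determinants *)

Section PSD.
Local Open Scope sesquilinear_scope.
Variable C : numClosedFieldType.

(** In a unitary eigenbasis the determinant is a product of factors 1 plus a nonnegative
    eigenvalue. *)
Lemma det_add1_psd_ge1 n (M : 'M[C]_n) : M ^t* = M ->
  (forall v : 'rV[C]_n, 0 <= (v *m M *m v ^t*) 0 0) -> 1 <= \det (1%:M + M).
Proof.
move=> Mh Mp.
have Mn : M \is normalmx by apply/normalmxP; rewrite Mh.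
have /orthomx_spectralP ME := Mn.
set S := spectralmx M in ME; set D := spectral_diag M in ME.
have Su : S \is unitarymx by exact: spectral_unitarymx.
have Sunit : S \in unitmx by exact: unitarymx_unit.
have SM : S *m M *m S ^t* = diag_mx D.
  rewrite [X in _ *m X *m _]ME !mulmxA mulmxV// mul1mx.
  by rewrite -mulmxA (unitarymxP Su) mulmx1.
have D0 i : 0 <= D 0 i.
  have := Mp (row i S).
  rewrite -row_mul.
  have -> : (row i (S *m M) *m (row i S) ^t*) 0 0 = (S *m M *m S ^t*) i i.
    by rewrite !mxE; apply: eq_bigr => k _; rewrite !mxE.
  by rewrite SM mxE eqxx.
have -> : \det (1%:M + M) = \det (diag_mx (const_mx 1 + D)).
  have -> : diag_mx (const_mx 1 + D) = S *m (1%:M + M) *m invmx S.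
    rewrite mulmxDr mulmx1 mulmxDl mulmxV// (invmx_unitary Su) SM raddfD/=.
    by rewrite diag_const_mx.
  rewrite !det_mulmx mulrAC -det_mulmx mulmxV// det1 mul1r//.
rewrite det_diag; elim/big_ind: _ => // [x y x1 y1|i _]; first by rewrite -[1]mulr1 ler_pM.
by rewrite !mxE lerDl.
Qed.

Lemma det_capacity_ge1 m n (H : 'M[C]_(m, n)) (K : 'M[C]_n) : K ^t* = K ->
  (forall v : 'rV[C]_n, 0 <= (v *m K *m v ^t*) 0 0) ->
  1 <= \det (1%:M + H *m K *m H ^t*).
Proof.
move=> Kh Kp; apply: det_add1_psd_ge1; first by rewrite !trmxC_mul trmxCK Kh mulmxA.
by move=> v; have := Kp (v *m H); rewrite trmxC_mul !mulmxA.
Qed.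

End PSD.

(** * Boxes of Gaussian entries *)

Section Boxes.
Variable R : realType.

(** On the interval the density is at least its value at distance [B + 1] from the mean, and the
    length is [2 h]. *)
Lemma normal_prob_itv_ge (s B : R) : s != 0 -> 0 <= B ->
  exists2 c : R, 0 < c & forall x h : R, `|x| <= B -> 0 < h <= 1 ->
    ((c * h)%:E <= normal_prob 0 s `](x - h)%R, (x + h)%R[%classic)%E.
Proof.
move=> s0 B0; pose c0 := normal_peak s * expR (- (B + 1) ^+ 2 / (s ^+ 2 *+ 2)).
have pk : 0 < normal_peak s by exact: normal_peak_gt0.
have c00 : 0 < c0 by rewrite mulr_gt0// expR_gt0.
exists (c0 * 2); first by rewrite mulr_gt0.
move=> x h xB /andP[h0 h1]; rewrite /normal_prob.
have -> : (c0 * 2 * h)%:E = (\int[lebesgue_measure]_(y in `](x - h)%R, (x + h)%R[) c0%:E)%E.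
  rewrite integral_cst//= lebesgue_measure_itv/= lte_fin ltrBlDr -addrA ltrDl addr_gt0//.
  rewrite -EFinB -EFinM; congr _%:E; ring.
apply: ge0_le_integral => //.
- by move=> y _; rewrite lee_fin ltW.
- by apply/measurable_EFinP; apply: measurable_funS (measurable_normal_pdf 0 s).
- move=> y /=; rewrite in_itv/= lee_fin => /andP[y1 y2].
  rewrite normal_pdfE// /normal_fun/c0 ler_pM2l// ler_expR subr0 !mulNr lerN2.
  rewrite ler_wpM2r ?invr_ge0 ?mulrn_wge0 ?sqr_ge0//.
  rewrite -real_normK ?num_real// lerXn2r ?nnegrE ?addr_ge0//.
  by move: xB; rewrite !ler_norml => /andP[]; lra.
Qed.

Lemma prod_seq_ge_cst (I : eqType) (s : seq I) (p : I -> \bar R) (a : R) : 0 <= a ->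
  (forall k, (a%:E <= p k)%E) -> ((a ^+ size s)%:E <= \prod_(k <- s) p k)%E.
Proof.
move=> a0 h; elim: s => [|k s IH]; first by rewrite big_nil expr0.
rewrite big_cons/= exprS EFinM; apply: lee_pmul => //; rewrite lee_fin//.
exact: exprn_ge0.
Qed.

Lemma probability_disjoint_ge d (T : measurableType d) (P : probability T R) (I : choiceType)
    (s : seq I) (F : I -> set T) (a : R) : uniq s ->
  (forall i, measurable (F i)) ->
  (forall i j w, i \in s -> j \in s -> F i w -> F j w -> i = j) ->
  (forall i, i \in s -> (a%:E <= P (F i))%E) ->
  (((size s)%:R * a)%:E <= P (\big[setU/set0]_(i <- s) F i))%E.
Proof.
move=> + mF; elim: s => [|i s IH] /=; first by rewrite big_nil mul0r measure0.
move=> /andP[nis us] hd ha.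
rewrite big_cons measureU//.
- rewrite -natr1 mulrDl mul1r addrC EFinD; apply: leeD; first by apply: ha; rewrite mem_head.
  apply: IH => //.
    by move=> j k w js ks; apply: hd; rewrite inE ?js ?ks orbT.
  by move=> j js; apply: ha; rewrite inE js orbT.
- exact: bigsetU_measurable.
- rewrite -subset0 => w [Fi]; rewrite -bigcup_seq => -[j /= js Fj].
  by have := hd i j w (mem_head _ _); rewrite inE js orbT => /(_ isT Fi Fj) e; rewrite e js in nis.
Qed.

Definition coord m n (A : 'M[R[i]]_(m, n)) (k : 'I_m * 'I_n * bool) : R :=
  if k.2 then complex.Re (A k.1.1 k.1.2) else complex.Im (A k.1.1 k.1.2).

(** By independence a box has the product of its interval probabilities, and disjoint boxes add up.
    The constant is fixed before the number of boxes and their side, both of which will vary with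
    the SNR. *)
Lemma iid_CN_boxes_ge m n (B : R) : 0 <= B ->
  exists2 c : R, 0 < c & forall d (T : measurableType d) (P : probability T R)
    (G : T -> 'M[R[i]]_(m, n)) (I : choiceType) (s : seq I) (A : I -> 'M[R[i]]_(m, n)) (h : R),
  iid_CN P G -> 0 < h <= 1 -> uniq s ->
  (forall i k, i \in s -> `|coord (A i) k| <= B) ->
  (forall i j M, i \in s -> j \in s -> (forall k, `|coord M k - coord (A i) k| < h) ->
     (forall k, `|coord M k - coord (A j) k| < h) -> i = j) ->
  exists E : set T, [/\ measurable E,
    (((size s)%:R * (c * h) ^+ #|{: 'I_m * 'I_n * bool}|)%:E <= P E)%E &
    forall w, E w -> exists2 i, i \in s & forall k, `|coord (G w) k - coord (A i) k| < h].
Proof.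
move=> B0.
have s0 : Num.sqrt 2^-1 != 0 :> R by rewrite gt_eqF// sqrtr_gt0 invr_gt0.
have [c c0 hc] := normal_prob_itv_ge s0 B0.
exists c => // d T P G I s A h [mX dX iX] h01 us hB hdis.
pose J i k : set R := `](coord (A i) k - h)%R, (coord (A i) k + h)%R[%classic.
have JE i k w : ((fun w => coord (G w) k) @^-1` J i k) w <-> `|coord (G w) k - coord (A i) k| < h.
  rewrite /J /= in_itv/= ltr_norml; split=> /andP[? ?]; apply/andP; split; lra.
pose F i : set T := \bigcap_(k in setT) ((fun w => coord (G w) k) @^-1` J i k).
have mF i : measurable (F i).
  apply: fin_bigcap_measurable => // k _; rewrite -[X in measurable X]setTI.
  by apply: mX => //; exact: measurable_itv.
exists (\big[setU/set0]_(i <- s) F i); split.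
- exact: bigsetU_measurable.
- apply: probability_disjoint_ge => //.
    move=> i j w is_ js_ Fi Fj; apply: (hdis i j (G w)) => // k.
      by apply/JE; exact: Fi.
    by apply/JE; exact: Fj.
  move=> i is_; rewrite /F (iX (J i))//; last by move=> k; exact: measurable_itv.
  rewrite cardE -[index_enum _]enumT; apply: prod_seq_ge_cst.
    by rewrite mulr_ge0 ?ltW//; case/andP: h01.
  by move=> k; rewrite dX; [apply: hc => //; exact: hB|exact: measurable_itv].
- move=> w; rewrite -bigcup_seq => -[i /= is_ Fi]; exists i => // k.
  by apply/JE; exact: Fi.
Qed.

End Boxes.

(** * Triangular parametrisation of low-rank matrices *)

Section LU.
Variable F : numFieldType.
Implicit Types (D : nat -> F) (Z : nat -> nat -> F).

(** One table [Z] stores both factors, as in an in-place LU decomposition: [L] has unit diagonal and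
    reads below it, [U] reads the diagonal and above. *)
Definition lu_entryL Z i t : F := if (t < i)%N then Z i t else (t == i)%:R.
Definition lu_entryU Z t j : F := if (t <= j)%N then Z t j else 0.

Definition luL a q Z : 'M[F]_(a, q) := \matrix_(i, t) lu_entryL Z i t.
Definition luU q b Z : 'M[F]_(q, b) := \matrix_(t, j) lu_entryU Z t j.
Definition lu_mx a b q D Z : 'M[F]_(a, b) :=
  luL a q Z *m diag_mx (\row_t D t) *m luU q b Z.

(** Parameters are recovered by elimination, in increasing order of [minn i j]; the discreteness
    hypothesis turns each small discrepancy into equality. *)
Lemma lu_mx_separated a b q D Z Z' (delta : F) :
  (forall t, (t < q)%N -> 0 <= D t) ->
  (forall t, (t < q)%N -> 1 <= `|Z t t|) ->
  (forall i j, (i < a)%N -> (j < b)%N -> (minn i j < q)%N ->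
     D (minn i j) * `|Z i j - Z' i j| <= delta -> Z i j = Z' i j) ->
  (forall i j, `|lu_mx a b q D Z i j - lu_mx a b q D Z' i j| <= delta) ->
  forall i j, (i < a)%N -> (j < b)%N -> (minn i j < q)%N -> Z i j = Z' i j.
Proof.
move=> D0 pivot disc close.
suff H m : (m < q)%N -> forall i j, (i < a)%N -> (j < b)%N -> minn i j = m -> Z i j = Z' i j.
  by move=> i j ia jb ijq; exact: (H (minn i j)).
have [k] := ubnP m; elim: k m => // k IH m mk mq.
pose T Y i t j := lu_entryL Y i t * D t * lu_entryU Y t j.
have entryE Y (i : 'I_a) (j : 'I_b) : lu_mx a b q D Y i j = \sum_(t < q) T Y i t j.
  by rewrite mxE; apply: eq_bigr => t _; rewrite mul_mx_diag !mxE.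
(* Terms [t < m] agree by induction and terms [t > m] vanish by triangularity, so only the term
   [t = m] remains. *)
have diff i j : (i < a)%N -> (j < b)%N -> minn i j = m -> `|T Z i m j - T Z' i m j| <= delta.
  move=> ia jb ijm; have := close (Ordinal ia) (Ordinal jb).
  rewrite !entryE -sumrB (bigD1 (Ordinal mq))//= big1 ?addr0// => t tm.
  have mi : (m <= i)%N by rewrite -ijm geq_minl.
  have mj : (m <= j)%N by rewrite -ijm geq_minr.
  have [tltm|] := ltnP t m.
    have ti : (t < i)%N by apply: leq_trans mi.
    have tj : (t < j)%N by apply: leq_trans mj.
    have tk : (t < k)%N by apply: leq_trans tltm _; rewrite -ltnS.
    have tb : (t < b)%N by apply: ltn_trans jb.
    have ta : (t < a)%N by apply: ltn_trans ia.
    rewrite /T /lu_entryL /lu_entryU ti (ltnW tj).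
    rewrite (IH t tk _ i t)// ?(IH t tk _ t j)// ?subrr//.
      exact/minn_idPl/ltnW.
    exact/minn_idPr/ltnW.
  rewrite leq_eqVlt => /predU1P[mt|mt]; first by rewrite -val_eqE /= mt eqxx in tm.
  suff TY Y : T Y i t j = 0 by rewrite !TY subrr.
  rewrite /T /lu_entryL /lu_entryU; move: ijm; case: (leqP i j) => ij ijm.
    by rewrite ijm ltnNge (ltnW mt)/= gtn_eqF// !mul0r.
  by rewrite ijm [(t <= m)%N]leqNgt mt/= mulr0.
have rowE j : (m < a)%N -> (m <= j)%N -> (j < b)%N -> Z m j = Z' m j.
  move=> ma mj jb; apply: disc => //; rewrite (minn_idPl mj)//.
  have := diff m j ma jb (minn_idPl mj).
  rewrite /T /lu_entryL /lu_entryU ltnn eqxx mj !mul1r -mulrBr normrM.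
  by rewrite ger0_norm// D0.
move=> i j ia jb; case: (leqP i j) => ij ijm; first by subst m; exact: rowE.
subst j; have ma : (m < a)%N by apply: ltn_trans ia.
(* Row [m] comes first because it yields the common pivot. Column differences are multiplied by this
   pivot, of modulus at least 1, so removing it keeps them below [delta]. *)
have piv := rowE m ma (leqnn m) jb.
apply: disc => //; rewrite (minn_idPr (ltnW ij))//.
have := diff i m ia jb (minn_idPr (ltnW ij)).
rewrite /T /lu_entryL /lu_entryU ij leqnn -piv -mulrBl -mulrBl !normrM.
rewrite (ger0_norm (D0 m mq)); apply: le_trans.
by rewrite [leLHS]mulrC ler_peMr ?mulr_ge0 ?D0// pivot.
Qed.

Lemma mxbounded_luL a q Z (B : F) : 1 <= B ->
  (forall i j, (i < a)%N -> `|Z i j| <= B) -> mxbounded B (luL a q Z).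
Proof.
move=> B1 h i t; rewrite mxE /lu_entryL; case: ltnP => _; first exact: h.
case: eqP => _; rewrite ?normr1 ?normr0 ?(le_trans _ B1)//.
Qed.

End LU.

(** * Gaussian matrices close to low rank *)

Section LowRank.
Local Open Scope complex_scope.
Variable R : realType.
Local Notation C := R[i].

Lemma natr_complex (n : nat) : n%:R = (n%:R : R)%:C :> C.
Proof. by rewrite rmorph_nat. Qed.

Lemma normc_le_ReIm (z : C) : `|z| <= (`|complex.Re z| + `|complex.Im z|)%:C.
Proof.
rewrite normc_def lecR; set x := complex.Re z; set y := complex.Im z.
rewrite -[leRHS]ger0_norm ?addr_ge0// -sqrtr_sqr ler_wsqrtr//.
rewrite sqrrD !real_normK ?num_real// -addrA lerD2l lerDr mulrn_wge0// mulr_ge0//.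
Qed.

Lemma ReIm_le_normc (z : C) (B : R) : `|z| <= B%:C ->
  `|complex.Re z| <= B /\ `|complex.Im z| <= B.
Proof.
rewrite normc_def lecR => h; split; apply: le_trans h; rewrite -sqrtr_sqr ler_wsqrtr//.
  by rewrite lerDl sqr_ge0.
by rewrite lerDr sqr_ge0.
Qed.

Lemma coordB m n (A B : 'M[C]_(m, n)) k : coord (A - B) k = coord A k - coord B k.
Proof. by rewrite /coord !mxE; case: k.2; case: (A _ _) => ? ?; case: (B _ _). Qed.

Lemma coord_le m n (A : 'M[C]_(m, n)) (B : R) : mxbounded B%:C A -> forall k, `|coord A k| <= B.
Proof. by move=> h [[i j] []]; have [] := ReIm_le_normc (h i j). Qed.

Lemma mxbounded_coord m n (A : 'M[C]_(m, n)) (B : R) :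
  (forall k, `|coord A k| <= B) -> mxbounded (B *+ 2)%:C A.
Proof.
move=> h i j; apply: le_trans (normc_le_ReIm _) _; rewrite lecR mulr2n.
by apply: lerD; [exact: (h (i, j, true))|exact: (h (i, j, false))].
Qed.

Lemma card_ord_ltn N M : (M <= N)%N -> #|[pred z : 'I_N | (z < M)%N]| = M.
Proof.
move=> MN; rewrite -sum1_card -(big_ord_widen _ (fun=> 1%N) MN).
by rewrite sum1_card card_ord.
Qed.

(** The offset 1 in the real part keeps the pivots of modulus at least 1. The mesh depends on
    [minn i j], the index of the scale that multiplies the parameter; 1 is a default outside the
    matrix. *)
Definition grid_param a b (M : nat -> nat) N (f : {ffun 'I_a * 'I_b * bool -> 'I_N})
    (i j : nat) : C :=
  if (insub i, insub j) is (Some i', Some j') then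
    ((1 + (f (i', j', true))%:R / (M (minn i j))%:R) +i*
     ((f (i', j', false))%:R / (M (minn i j))%:R)) else 1.

Lemma grid_paramE a b M N (f : {ffun 'I_a * 'I_b * bool -> 'I_N}) (i : 'I_a) (j : 'I_b) :
  grid_param M f i j = ((1 + (f (i, j, true))%:R / (M (minn i j))%:R) +i*
     ((f (i, j, false))%:R / (M (minn i j))%:R)).
Proof. by rewrite /grid_param !valK. Qed.

Lemma dist_nat_lt1 (m n : nat) : `|m%:R - n%:R : R| < 1 -> m = n.
Proof.
wlog mn : m n / (m <= n)%N.
  by move=> h; case/orP: (leq_total m n) => [/h//|/h{}h]; rewrite distrC => /h.
rewrite distrC ger0_norm ?subr_ge0 ?ler_nat// -natrB// ltrn1 ?ltnS ?leqn0 subn_eq0 => nm.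
by apply/eqP; rewrite eqn_leq mn.
Qed.

(** Each real coordinate with [minn i j < q] has at least [dd / eps] grid values and costs a factor
    of order [eps] in the box probability, so an entry contributes [dd ^+ 2]. The other entries keep
    a single grid value and contribute [eps ^+ 2]. *)
Lemma iid_CN_lowrank_ge a b q : (q <= a)%N -> (q <= b)%N ->
  exists2 c : R, 0 < c & forall d (T : measurableType d) (P : probability T R)
    (G : T -> 'M[C]_(a, b)) (dd : nat -> R) (eps : R),
  iid_CN P G -> 0 < eps <= 1 -> (forall t, (t < q)%N -> eps <= dd t <= 1) ->
  exists E : set T, [/\ measurable E,
    ((c * \prod_(i < a) \prod_(j < b)
       (if (minn i j < q)%N then dd (minn i j) else eps) ^+ 2)%:E <= P E)%E &
    forall w, E w -> exists (L : 'M[C]_(a, q)) (U : 'M[C]_(q, b)) (De : 'M[C]_(a, b)),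
      [/\ mxbounded 30%:R L, mxbounded 30%:R U, mxbounded 30%:R De &
        G w = L *m diag_mx (\row_t (dd t)%:C) *m U + eps%:C *: De]].
Proof.
(* The scales are rounded up to the multiples [D t = 5 * eps * M t], so that a grid step
   [(M t)^-1] moves an entry by at least [5 * eps], too far for boxes of half-side [eps] to meet. *)
move=> qa qb; pose B : R := (q%:R * (3 * 30)).
have B0 : 0 <= B by rewrite mulr_ge0.
have [c c0 hc] := @iid_CN_boxes_ge R a b B B0.
pose I := ('I_a * 'I_b * bool)%type.
exists (c ^+ #|{: I}|); first exact: exprn_gt0.
move=> d T P G dd eps Giid eps01 hdd; have /andP[e0 e1] := eps01.
pose M t := if (t < q)%N then (Num.truncn (dd t / eps)).+1 else 1%N.
(* [N] bounds all grid sizes, so that grid points are functions into one ordinal type. *)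
pose N := (Num.truncn eps^-1).+1.
have dd0 t : (t < q)%N -> 0 < dd t by move=> /hdd/andP[h _]; exact: lt_le_trans h.
have MN t : (M t <= N)%N.
  rewrite /M; case: ltnP => // tq; rewrite ltnS le_truncn// ler_pdivrMr// mulVf ?gt_eqF//.
  by have /andP[] := hdd t tq.
have M0 t : 0 < (M t)%:R :> R by rewrite /M; case: ifP.
have M1 t : (q <= t)%N -> M t = 1%N by rewrite /M ltnNge => ->.
pose D t : R := 5 * eps * (M t)%:R.
have D0 t : 0 < D t by rewrite !mulr_gt0.
have MD t : (t < q)%N -> dd t <= eps * (M t)%:R <= 2 * dd t.
  move=> tq; have dd0t := dd0 t tq.
  have := truncn_itv (divr_ge0 (ltW dd0t) (ltW e0)); rewrite /M tq => /andP[h1 h2].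
  rewrite ler_pdivlMr// in h1; rewrite ltr_pdivrMr// in h2.
  rewrite mulrC (ltW h2)/= -natr1 mulrDl mul1r.
  by have /andP[h3 _] := hdd t tq; lra.
pose K (k : I) := [pred z : 'I_N | (z < M (minn k.1.1 k.1.2))%N].
pose s : seq {ffun I -> 'I_N} := enum (family K).
have sP f : f \in s -> forall k, (f k < M (minn k.1.1 k.1.2))%N.
  by rewrite mem_enum => /familyP h k; have := h k.
pose Z (f : {ffun I -> 'I_N}) := grid_param M f.
pose G0 (f : {ffun I -> 'I_N}) : 'M[C]_(a, b) := lu_mx a b q (fun t => (D t)%:C) (Z f).
have Zb f i j : f \in s -> `|Z f i j| <= 3%:R.
  move=> fs; rewrite /Z /grid_param; case: insubP => [i' _ ii|_]; last by rewrite normr1 ler1n.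
  case: insubP => [j' _ jj|_]; last by rewrite normr1 ler1n.
  apply: le_trans (normc_le_ReIm _) _.
  rewrite (natr_complex 3) lecR /=.
  have f1 := sP f fs (i', j', true); have f2 := sP f fs (i', j', false).
  rewrite /= ii jj in f1 f2.
  have g1 (x : nat) : (x < M (minn i j))%N -> 0 <= (x%:R / (M (minn i j))%:R : R) <= 1.
    by move=> xM; rewrite divr_ge0 ?ler0n//= ler_pdivrMr// mul1r ler_nat ltnW.
  have /andP[a1 a2] := g1 _ f1; have /andP[a3 a4] := g1 _ f2.
  by rewrite !ger0_norm ?addr_ge0//; lra.
have hU f : f \in s -> mxbounded 30%:R (diag_mx (\row_(t < q) (D t)%:C) *m luU q b (Z f)).
  move=> fs t j; rewrite mul_diag_mx !mxE normrM.
  have /andP[m1 m2] := MD t (ltn_ord t).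
  have /andP[_ m3] := hdd t (ltn_ord t).
  have -> : 30%:R = 10%:R * 3%:R :> C by rewrite -natrM.
  apply: ler_pM => //; last first.
    by rewrite /lu_entryU; case: ifP => _; rewrite ?normr0 ?ler0n ?Zb.
  rewrite ger0_norm ?lecR ?(ltW (D0 t))// (natr_complex 10) lecR.
  by rewrite /D -mulrA; lra.
have hL f : f \in s -> mxbounded 3%:R (luL a q (Z f)).
  by move=> fs; apply: mxbounded_luL; [rewrite ler1n|move=> i j _; exact: Zb].
have G0b f : f \in s -> mxbounded B%:C (G0 f).
  move=> fs; have := mxbounded_mul (hL f fs) (hU f fs); rewrite mulmxA.
  by rewrite -!natrM natr_complex /B -natrM -natrM.
have sep f f' A : f \in s -> f' \in s -> (forall k, `|coord A k - coord (G0 f) k| < eps) ->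
     (forall k, `|coord A k - coord (G0 f') k| < eps) -> f = f'.
  move=> fs fs' h1 h2.
  (* If two boxes meet, the coordinates of their centres differ by less than [2 * eps] and their
     entries by at most [4 * eps], below the displacement [5 * eps] of a grid step. *)
  have close i j : `|G0 f i j - G0 f' i j| <= (4 * eps)%:C.
    have -> : 4 * eps = (2 * eps) *+ 2 by rewrite -mulr_natl; ring.
    have : mxbounded ((2 * eps) *+ 2)%:C (G0 f - G0 f').
      apply: mxbounded_coord => k; rewrite coordB.
      have := h1 k; have := h2 k; rewrite !ltr_norml ler_norml; lra.
    by move/(_ i j); rewrite !mxE.
  have dsc (i : 'I_a) (j : 'I_b) : (minn i j < q)%N ->
     (D (minn i j))%:C * `|Z f i j - Z f' i j| <= (4 * eps)%:C ->
     f (i, j, true) = f' (i, j, true) /\ f (i, j, false) = f' (i, j, false).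
    move=> ijq; set m := minn i j => hle.
    have hle' : `|Z f i j - Z f' i j| <= (4 * eps / D m)%:C.
      rewrite -(ler_pM2l (_ : 0 < (D m)%:C)) ?ltcR//; apply: le_trans hle _.
      by rewrite -rmorphM /= lecR [leRHS]mulrC divfK// gt_eqF.
    have [] := ReIm_le_normc hle'; rewrite /Z !grid_paramE /= -/m.
    have E (x y : nat) : `|x%:R / (M m)%:R - y%:R / (M m)%:R| <= 4 * eps / D m -> x = y :> nat.
      rewrite -mulrBl normrM normfV (gtr0_norm (M0 m)) ler_pdivrMr// => hxy.
      apply: dist_nat_lt1; apply: le_lt_trans hxy _; rewrite /D.
      have -> : 4 * eps / (5 * eps * (M m)%:R) * (M m)%:R = 4 / 5.
        have : (M m)%:R != 0 :> R by rewrite gt_eqF.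
        have : eps != 0 by rewrite gt_eqF.
        by move=> ? ?; field; apply/andP.
      lra.
    rewrite (_ : forall x y z : R, x + y - (x + z) = y - z); last by move=> *; ring.
    by move=> /E e1' /E e2'; split; apply: val_inj.
  apply/ffunP => -[[i j] bb].
  have [ijq|ijq] := ltnP (minn i j) q; last first.
    have := sP f fs (i, j, bb); have := sP f' fs' (i, j, bb).
    rewrite /= (M1 _ ijq) !ltnS !leqn0 => /eqP e /eqP e'.
    by apply: val_inj; rewrite /= e e'.
  have ZE : Z f i j = Z f' i j.
    apply: (@lu_mx_separated _ a b q (fun t => (D t)%:C) (Z f) (Z f') (4 * eps)%:C) => //.
    - by move=> t _; rewrite lecR ltW.
    - move=> t tq; have ta : (t < a)%N by apply: leq_trans qa.
      have tb : (t < b)%N by apply: leq_trans qb.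
      rewrite -[X in Z f X t]/(nat_of_ord (Ordinal ta)) -[X in Z f _ X]/(nat_of_ord (Ordinal tb)).
      apply: le_trans (normc_ge_Re _); rewrite [leLHS](_ : 1 = (1 : R)%:C) ?lecR ?rmorph1//.
      rewrite /Z grid_paramE /= ger0_norm ?addr_ge0 ?divr_ge0// lerDl divr_ge0//.
    - move=> i' j' ia jb ijq' hle.
      have [e1' e2'] := dsc (Ordinal ia) (Ordinal jb) ijq' hle.
      have := grid_paramE M f (Ordinal ia) (Ordinal jb).
      have := grid_paramE M f' (Ordinal ia) (Ordinal jb).
      by rewrite /= -/(Z f) -/(Z f') => -> ->; rewrite e1' e2'.
  have [] := dsc i j ijq; first by rewrite ZE subrr normr0 mulr0 lecR mulr_ge0// ltW.
  by case: bb.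
have [E [mE PE hE]] := hc _ T P G _ s G0 eps Giid eps01 (enum_uniq _)
   (fun f k fs => coord_le (G0b f fs) k) sep.
exists E; split => //.
  apply: le_trans PE; rewrite lee_fin.
  have -> : (size s)%:R = \prod_(k : I) (M (minn k.1.1 k.1.2))%:R :> R.
    rewrite /s -cardE card_family foldrE big_map big_enum /= -natr_prod; congr _%:R.
    by apply: eq_bigr => k _; rewrite card_ord_ltn.
  rewrite exprMn mulrCA ler_wpM2l ?exprn_ge0 ?(ltW c0)//.
  rewrite -[X in _ * X]prodr_const -big_split/=.
  rewrite pair_bigA/=.
  rewrite (_ : \prod_(p : 'I_a * 'I_b) _ = \prod_(p : 'I_a * 'I_b) \prod_(bb : bool)
     (if (minn p.1 p.2 < q)%N then dd (minn p.1 p.2) else eps)); last first.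
    by apply: eq_bigr => p _; rewrite prodr_const card_bool.
  rewrite pair_bigA/=; apply: ler_prod => -[[i j] bb] _ /=.
  case: ltnP => ijq; last by rewrite (ltW e0) (M1 _ ijq) mul1r lexx.
  by rewrite (ltW (dd0 _ ijq)) mulrC; have /andP[] := MD _ ijq.
move=> w /hE[f fs hf].
(* The factor [U] absorbs the ratio of the rounded scale [D t] to [dd t], at most 10 since
   [eps * M t <= 2 * dd t]; with entries of [Z] at most 3 this gives 30. *)
exists (luL a q (Z f)), (diag_mx (\row_(t < q) (D t / dd t)%:C) *m luU q b (Z f)),
  (eps^-1%:C *: (G w - G0 f)); split.
- by apply: mxbounded_le (hL f fs); rewrite ler_nat.
- move=> t j; rewrite mul_diag_mx !mxE normrM.
  have /andP[m1 m2] := MD t (ltn_ord t).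
  have d0 := dd0 t (ltn_ord t).
  have -> : 30%:R = 10%:R * 3%:R :> C by rewrite -natrM.
  apply: ler_pM => //; last first.
    by rewrite /lu_entryU; case: ifP => _; rewrite ?normr0 ?ler0n ?Zb.
  rewrite ger0_norm ?lecR ?divr_ge0 ?(ltW (D0 t)) ?(ltW d0)// (natr_complex 10) lecR.
  by rewrite ler_pdivrMr// /D -mulrA; lra.
- have hb : mxbounded (eps *+ 2)%:C (G w - G0 f).
    by apply: mxbounded_coord => k; rewrite coordB ltW.
  move=> i j; rewrite mxE normrM ger0_norm ?lecR ?invr_ge0 ?(ltW e0)//.
  apply: (@le_trans _ _ ((eps^-1)%:C * (eps *+ 2)%:C)).
    by rewrite ler_pM2l ?ltcR ?invr_gt0// hb.
  rewrite -rmorphM /= (natr_complex 30) lecR mulrnAr mulVf ?gt_eqF//.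
  by rewrite ler_nat.
- rewrite scalerA -rmorphM /= divff ?gt_eqF// scale1r.
  have -> : luL a q (Z f) *m diag_mx (\row_t (dd t)%:C) *m
       (diag_mx (\row_(t < q) (D t / dd t)%:C) *m luU q b (Z f)) = G0 f.
    rewrite /G0 /lu_mx mulmxA -(mulmxA (luL _ _ _)) mulmx_diag; congr (_ *m diag_mx _ *m _).
    apply/rowP => t; rewrite !mxE -rmorphM /=; congr _%:C.
    by rewrite mulrC divfK// gt_eqF// dd0.
  by rewrite addrC subrK.
Qed.

End LowRank.

(** * Outage exponents *)

Section Core.
Local Open Scope complex_scope.
Local Open Scope sesquilinear_scope.
Variable R : realType.
Local Notation C := R[i].

Lemma mxbounded_ex m n (A : 'M[C]_(m, n)) : exists2 B : R, 1 <= B & mxbounded B%:C A.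
Proof.
pose f i j : R := `|complex.Re (A i j)| + `|complex.Im (A i j)|.
have f0 i j : 0 <= f i j by rewrite addr_ge0.
exists (1 + \sum_i \sum_j f i j).
  by rewrite lerDl sumr_ge0// => i _; rewrite sumr_ge0.
move=> i j; apply: le_trans (normc_le_ReIm _) _; rewrite lecR -/(f i j).
rewrite (bigD1 i)//= (bigD1 j)//=.
have h1 : 0 <= \sum_(j0 < n | j0 != j) f i j0 by rewrite sumr_ge0.
have h2 : 0 <= \sum_(i0 < m | i0 != i) \sum_j f i0 j.
  by rewrite sumr_ge0// => i0 _; rewrite sumr_ge0.
lra.
Qed.

Lemma mxbounded_sel n N (s : 'I_n -> 'I_N) : mxbounded (1 : R)%:C (sel_mx R s).
Proof. by move=> i j; rewrite mxE rmorph1; case: (_ == _); rewrite ?normr1 ?normr0. Qed.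

Lemma Re_le_of_norm (z w : C) : `|z| <= w -> complex.Re z <= complex.Re w.
Proof.
move=> h; have := le_trans (normc_ge_Re z) h; rewrite lecE /= => /andP[_].
by apply: le_trans; exact: ler_norm.
Qed.

(** Rules out outage at multiplexing gain 0. *)
Lemma rate_ge0 n m (H : 'M[C]_(n, m)) (K : 'M[C]_m) snr : input_cov snr K -> 0 <= rate H K.
Proof.
move=> [Kh Kp _]; rewrite /rate ln_ge0//.
by have := det_capacity_ge1 H Kh Kp; rewrite lecE => /andP[_].
Qed.

(* The [n + a] columns of [P] and rows of [Q] carry the scales [dd t] of the rank-[n] part and
   the common scale [eps] of the remainder. *)
Lemma channel_factor a b n (delta : R) (Ur : 'M[C]_a) (lr : 'I_a -> R) (Ut : 'M[C]_b)
    (lt : 'I_b -> R) nr nt :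
  exists2 B : R, 1 <= B & forall (L : 'M[C]_(a, n)) (U : 'M[C]_(n, b)) (De G : 'M[C]_(a, b))
    (dd : nat -> R) (eps : R) (sr : 'I_nr -> 'I_a) (st : 'I_nt -> 'I_b),
  mxbounded 30%:R L -> mxbounded 30%:R U -> mxbounded 30%:R De ->
  G = L *m diag_mx (\row_t (dd t)%:C) *m U + eps%:C *: De ->
  exists (P : 'M[C]_(nr, n + a)) (Q : 'M[C]_(n + a, nt)),
    [/\ mxbounded B%:C P, mxbounded B%:C Q &
     sel_mx R sr *m channel delta Ur lr Ut lt G *m (sel_mx R st)^T =
       P *m diag_mx (row_mx (\row_t (dd t)%:C) (const_mx eps%:C)) *m Q].
Proof.
(* [X] and [Y] collect the fixed correlation factors, so their entry bounds do not depend on the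
   SNR. *)
pose X := delta%:C *: (Ur *m diag_mx (\row_i (Num.sqrt (lr i))%:C)).
pose Y := (diag_mx (\row_j (Num.sqrt (lt j))%:C)) ^t* *m Ut ^t*.
have [B1 B11 hX] := mxbounded_ex X; have [B2 B21 hY] := mxbounded_ex Y.
pose Bx : R := a%:R * (1 * (a%:R * (B1 * 30))).
pose By : R := b%:R * ((b%:R * (30 * B2)) * 1).
have Bx0 : 0 <= Bx by rewrite !mulr_ge0// (le_trans _ B11).
have By0 : 0 <= By by rewrite !mulr_ge0// (le_trans _ B21).
exists (1 + Bx + By); first by rewrite -addrA lerDl addr_ge0.
move=> L U De G dd eps sr st hL hU hDe GE.
have b1 k (i j : 'I_k) : `|(1%:M : 'M[C]_k) i j| <= 30%:R.
  by rewrite mxE; case: (_ == _); rewrite ?normr1 ?normr0 ?ler0n ?ler1n.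
have hLI : mxbounded 30%:R (row_mx L (1%:M : 'M[C]_a)).
  by move=> i t; rewrite -[t]fintype.splitK; case: (fintype.split t) => j /=; rewrite ?row_mxEl ?row_mxEr.
have hUD : mxbounded 30%:R (col_mx U De).
  by move=> t j; rewrite -[t]fintype.splitK; case: (fintype.split t) => i /=; rewrite ?col_mxEu ?col_mxEd.
exists (sel_mx R sr *m (X *m row_mx L 1%:M)), ((col_mx U De *m Y) *m (sel_mx R st)^T); split.
- apply: mxbounded_le (mxbounded_mul (mxbounded_sel sr) (mxbounded_mul hX hLI)).
  rewrite !natr_complex -!rmorphM /= lecR.
  by rewrite -/Bx; lra.
- have hs : mxbounded (1 : R)%:C (sel_mx R st)^T by move=> i j; rewrite mxE; exact: mxbounded_sel.
  apply: mxbounded_le (mxbounded_mul (mxbounded_mul hUD hY) hs).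
  rewrite !natr_complex -!rmorphM /= lecR.
  by rewrite -/By; lra.
- have GE' : G = row_mx L 1%:M *m diag_mx (row_mx (\row_t (dd t)%:C) (const_mx eps%:C))
      *m col_mx U De.
    rewrite diag_mx_row mul_row_block !mulmx0 addr0 add0r mul_row_col GE; congr (_ + _).
    by rewrite mul1mx diag_const_mx mul_scalar_mx.
  rewrite /channel [in LHS]GE' /X /Y.
  rewrite !(=^~ scalemxAr, =^~ scalemxAl); congr (_ *: _).
  by rewrite !mulmxA.
Qed.

Lemma Re_realM (z : C) (x : R) : complex.Re (z * x%:C) = complex.Re z * x.
Proof. by case: z => u v /=; rewrite mulr0 subr0. Qed.

(** The expansion takes, twice, at most [n] of the scales 1, [rho * dd t] and [rho * eps]. Since
    [dd t >= eps] and [rho * eps >= 1], no choice exceeds the product of all [rho * dd t]. *)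
Lemma rate_lowrank_le a b n (delta : R) (Ur : 'M[C]_a) (lr : 'I_a -> R) (Ut : 'M[C]_b)
    (lt : 'I_b -> R) nr nt : minn nr nt = n ->
  exists2 B : R, 0 < B & forall (L : 'M[C]_(a, n)) (U : 'M[C]_(n, b)) (De G : 'M[C]_(a, b))
    (dd : nat -> R) (eps rho : R) (sr : 'I_nr -> 'I_a) (st : 'I_nt -> 'I_b) (K : 'M[C]_nt),
  mxbounded 30%:R L -> mxbounded 30%:R U -> mxbounded 30%:R De ->
  G = L *m diag_mx (\row_t (dd t)%:C) *m U + eps%:C *: De ->
  0 < eps -> (forall t, (t < n)%N -> eps <= dd t) -> 0 < rho -> 1 <= rho * eps ->
  input_cov (rho ^+ 2) K ->
  complex.Re (\det (1%:M + (sel_mx R sr *m channel delta Ur lr Ut lt G *m (sel_mx R st)^T) *m K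
    *m (sel_mx R sr *m channel delta Ur lr Ut lt G *m (sel_mx R st)^T) ^t*))
    <= B * \prod_(t < n) (rho * dd t) ^+ 2.
Proof.
move=> nE; have [B B1 hB] := @channel_factor a b n delta Ur lr Ut lt nr nt.
pose cap := complex.Re (cap_const nr nt (n + a) B%:C).
exists (`|cap| + 1); first by rewrite ltr_pwDr.
move=> L U De G dd eps rho sr st K hL hU hDe GE e0 edd rho0 rhoe [Kh Kp Kt].
have [P [Q [hP hQ ->]]] := hB L U De G dd eps sr st hL hU hDe GE.
have hK := psd_entry_le Kh Kp Kt.
have rmX (x : R) k : (x ^+ k)%:C = x%:C ^+ k by rewrite rmorphXn.
rewrite rmX in hK.
pose dv : 'rV[C]_(n + a) := row_mx (\row_t (dd t)%:C) (const_mx eps%:C).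
(* With [s = rho * eps], [s ^+ n] times the product of these ratios is exactly the product of the
   [rho * dd t]. *)
pose u : 'rV[C]_(n + a) := row_mx (\row_t (dd t / eps)%:C) (const_mx 1).
have en : eps != 0 by rewrite gt_eqF.
have B1c : 1 <= B%:C by rewrite -[1 : C]/((1 : R)%:C) lecR.
have rhoec : 1 <= (rho * eps)%:C by rewrite -[1 : C]/((1 : R)%:C) lecR.
have rho0c : 0 < rho%:C by rewrite ltcR.
have dv0 t : 0 <= dv 0 t.
  rewrite -[t]fintype.splitK; case: (fintype.split t) => j /=.
    by rewrite row_mxEl mxE lecR (le_trans (ltW e0))// edd.
  by rewrite row_mxEr mxE lecR ltW.
have dvu t : rho%:C * dv 0 t <= (rho * eps)%:C * u 0 t.
  rewrite -[t]fintype.splitK; case: (fintype.split t) => j /=.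
    by rewrite !row_mxEl !mxE -!rmorphM /= lecR -mulrA [eps * _]mulrC divfK.
  by rewrite !row_mxEr !mxE mulr1 -rmorphM.
have u1 t : 1 <= u 0 t.
  rewrite -[t]fintype.splitK; case: (fintype.split t) => j /=; last by rewrite row_mxEr mxE.
  by rewrite row_mxEl mxE -[1 : C]/((1 : R)%:C) lecR ler_pdivlMr// mul1r edd.
have H := norm_det_capacity_le B1c hP hQ rho0c hK dv0 dvu rhoec u1.
have {H} : `|\det (1%:M + P *m diag_mx dv *m Q *m K *m (P *m diag_mx dv *m Q) ^t*)|
    <= cap_const nr nt (n + a) B%:C * ((\prod_(t < n) (rho * dd t) ^+ 2)%:C).
  apply: le_trans H _; rewrite nE.
  rewrite le_eqVlt; apply/orP; left; apply/eqP; congr (_ * _).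
  rewrite big_split_ord/= [X in _ * (_ * X)]big1 ?mulr1; last by move=> i _; rewrite /u row_mxEr mxE.
  under eq_bigr do rewrite /u row_mxEl mxE.
  rewrite -rmorph_prod -rmX -rmorphM -rmX; congr _%:C.
  rewrite prodrXl; congr (_ ^+ 2).
  have -> : (rho * eps) ^+ n = \prod_(t < n) (rho * eps) by rewrite prodr_const card_ord.
  by rewrite -big_split/=; apply: eq_bigr => t _; rewrite -mulrA [eps * _]mulrC divfK.
move/Re_le_of_norm; rewrite Re_realM => h; apply: le_trans h _.
apply: ler_wpM2r; first by apply: prodr_ge0 => t _; rewrite sqr_ge0.
by rewrite -/cap; have := ler_norm cap; lra.
Qed.

End Core.

(** * Diversity exponents from scale profiles *)

Section Exponent.
Local Open Scope complex_scope.
Local Open Scope sesquilinear_scope.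
Variable R : realType.
Local Notation C := R[i].

Lemma prod_expR (I : Type) (s : seq I) (f : I -> R) :
  \prod_(i <- s) expR (f i) = expR (\sum_(i <- s) f i).
Proof.
elim: s => [|i s IH]; first by rewrite !big_nil expR0.
by rewrite !big_cons IH expRD.
Qed.

(** For large SNR the low-rank event lies inside the outage event. Its probability is at least a
    constant times SNR to minus the double sum, and the constant disappears after division by
    [ln snr]. *)
Lemma outage_exponent_le a b (delta : R) (Ur : 'M[C]_a) (lr : 'I_a -> R) (Ut : 'M[C]_b)
    (lt : 'I_b -> R) (d0 : measure_display) (T : measurableType d0) (P : probability T R)
    (G : T -> 'M[C]_(a, b)) (nr nt : nat)
    (selr : R -> 'M[C]_(a, b) -> 'I_nr -> 'I_a) (selt : R -> 'M[C]_(a, b) -> 'I_nt -> 'I_b)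
    (K : R -> 'M[C]_(a, b) -> 'M[C]_nt) (r d : R) (alpha : nat -> R) (beta : R) :
  (minn nr nt <= a)%N -> (minn nr nt <= b)%N ->
  iid_CN P G ->
  (forall snr Hm, 0 < snr -> input_cov snr (K snr Hm)) ->
  (forall snr, 0 < snr ->
     measurable (outage_event (fun w => channel delta Ur lr Ut lt (G w)) selr selt K snr r)) ->
  ln (fine (P (outage_event (fun w => channel delta Ur lr Ut lt (G w)) selr selt K snr r)))
    / ln snr @[snr --> +oo] --> - d ->
  (forall t, 0 <= alpha t <= beta) -> beta <= 1 ->
  (forall t, (minn nr nt <= t)%N -> alpha t = beta) ->
  \sum_(t < minn nr nt) (1 - alpha t) < r ->
  d <= \sum_(i < a) \sum_(j < b) alpha (minn i j).
Proof.
set n := minn nr nt => na nb Giid Kcov mO lim ha b1 hab hr.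
have [c c0 hE] := @iid_CN_lowrank_ge R a b n na nb.
have [B B0 hB] := @rate_lowrank_le R a b n delta Ur lr Ut lt nr nt erefl.
set e := \sum_(i < a) _; set S := \sum_(t < n) (1 - alpha t) in hr.
have S0 : 0 <= S.
  by apply: sumr_ge0 => t _; rewrite subr_ge0; have /andP[_ h] := ha t; exact: le_trans h b1.
have r0 : 0 < r by apply: le_lt_trans hr.
set O := outage_event _ _ _ _ in lim mO.
have key snr : 1 < snr -> ln B < (r - S) * ln snr ->
    c * expR (- (e * ln snr)) <= fine (P (O snr r)).
  move=> snr1 hsnr; set l := ln snr in hsnr *.
  have snr0 : 0 < snr by apply: lt_trans snr1.
  have l0 : 0 < l by exact: ln_gt0.
  have snrE : snr = expR l by rewrite lnK ?posrE.
  pose dd t := expR (- (alpha t * l / 2)).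
  pose eps := expR (- (beta * l / 2)).
  pose rho := expR (l / 2).
  have beta0 : 0 <= beta by have /andP[h1 h2] := ha 0%N; exact: le_trans h2.
  have eps01 : 0 < eps <= 1.
    by rewrite expR_gt0/= -expR0 ler_expR oppr_le0 divr_ge0 ?mulr_ge0 ?(ltW l0).
  have eps_dd t : eps <= dd t.
    by rewrite ler_expR lerN2 ler_wpM2r// ler_wpM2r ?(ltW l0)//; have /andP[] := ha t.
  have dd1 t : dd t <= 1.
    by rewrite -expR0 ler_expR oppr_le0 divr_ge0 ?mulr_ge0 ?(ltW l0)//; have /andP[] := ha t.
  have rho2 : rho ^+ 2 = snr by rewrite snrE -expRM_natl; congr expR; rewrite mulrC divfK.
  have [E [mE PE EG]] := hE _ T P G dd eps Giid eps01
    (fun t _ => introT andP (conj (eps_dd t) (dd1 t))).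
  have EO : E `<=` O snr r.
    move=> w /EG[L [U [De [hL hU hDe GE]]]].
    rewrite /O /outage_event /= /rate.
    set H := channel delta Ur lr Ut lt (G w).
    have := hB L U De (G w) dd eps rho (selr snr H) (selt snr H) (K snr H) hL hU hDe GE.
    rewrite rho2 => /(_ _ _ _ _ (Kcov _ _ snr0)).
    case/andP: eps01 => e0 _; move=> /(_ e0 (fun t _ => eps_dd t) (expR_gt0 _)) hdet.
    have {hdet} := hdet _.
    have -> : \prod_(t < n) (rho * dd t) ^+ 2 = expR (S * l).
      rewrite /S mulr_suml -prod_expR; apply: eq_bigr => t _.
      by rewrite /rho /dd -expRD -expRM_natl; congr expR; field.
    move=> /(_ _)/wrap[].
      by rewrite /rho /eps -expRD -expR0 ler_expR -mulrBl divr_ge0// subr_ge0 ler_piMl// ltW.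
    set D := complex.Re _ => hD.
    have rl : 0 < r * l by rewrite mulr_gt0.
    (* At a nonpositive argument [ln] takes the value 0, which is below [r * ln snr]. *)
    have [D0|D0] := leP D 0; first by rewrite ln0.
    apply: (@le_lt_trans _ _ (ln B + S * l)).
      rewrite -[X in _ + X]expRK -lnM ?posrE ?expR_gt0//.
      by rewrite ler_ln ?posrE// mulr_gt0// expR_gt0.
    by rewrite -ltrBrDr -mulrBl.
  have PO : (P E <= P (O snr r))%E by apply: le_measure => //; rewrite inE//; exact: mO.
  rewrite -lee_fin fineK ?fin_num_measure//; last exact: mO.
  apply: le_trans PO; apply: le_trans PE; rewrite lee_fin ler_pM2l//.
  rewrite le_eqVlt; apply/orP; left; apply/eqP.
  rewrite /e mulr_suml -sumrN -prod_expR; apply: eq_bigr => i _.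
  rewrite mulr_suml -sumrN -prod_expR; apply: eq_bigr => j _.
  (* From index [n] on the profile equals [beta], so the residual scale [eps] also has the form
     [dd (minn i j)]. *)
  have -> : (if (minn i j < n)%N then dd (minn i j) else eps) = dd (minn i j).
    by case: ltnP => // /hab aE; rewrite /dd aE.
  by rewrite /dd -expRM_natl; congr expR; field.
rewrite leNgt; apply/negP => ed.
pose eta := (d - e) / 2; have eta0 : 0 < eta by rewrite divr_gt0// subr_gt0.
have : \forall snr \near +oo, ln (fine (P (O snr r))) / ln snr < - d + eta.
  by apply: (cvgr_lt (- d)) => //; rewrite ltrDl.
move=> hlt.
(* Once [ln snr] exceeds [A], the first term secures the outage and the second makes [|ln c|]
   smaller than [eta * ln snr], where [eta] is half the supposed gap [d - e]. *)
pose A := Num.max (ln B / (r - S)) (`|ln c| / eta).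
near (pinfty_nbhs R) => snr.
have snr1 : 1 < snr by near: snr; exact: nbhs_pinfty_gt.
have snr0 : 0 < snr by apply: lt_trans snr1.
have lA : A < ln snr.
  have : expR A < snr by near: snr; apply: nbhs_pinfty_gt; exact: num_real.
  by rewrite -ltr_ln ?posrE ?expR_gt0// expRK.
have l0 : 0 < ln snr by exact: ln_gt0.
have h1 : ln B < (r - S) * ln snr.
  rewrite mulrC -ltr_pdivrMr ?subr_gt0//; apply: le_lt_trans lA.
  by rewrite le_max lexx.
have h2 : `|ln c| < eta * ln snr.
  rewrite mulrC -ltr_pdivrMr//; apply: le_lt_trans lA.
  by rewrite le_max lexx orbT.
have hk := key snr snr1 h1.
have : ln (fine (P (O snr r))) / ln snr < - d + eta by near: snr.
apply/negP; rewrite -leNgt ler_pdivlMr//.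
have ce : 0 < c * expR (- (e * ln snr)) by rewrite mulr_gt0// expR_gt0.
have : ln (c * expR (- (e * ln snr))) <= ln (fine (P (O snr r))).
  by rewrite ler_ln ?posrE// (lt_le_trans ce).
apply: le_trans; rewrite lnM ?posrE ?expR_gt0// expRK.
have : - `|ln c| <= ln c by rewrite lerNl -normrN ler_norm.
have -> : (- d + eta) * ln snr = - (e * ln snr) - eta * ln snr by rewrite /eta; field.
lra.
Unshelve. all: by end_near. Qed.

Lemma sum_leq_ord a k : (k <= a)%N -> \sum_(i < a) (k <= i)%:R = a%:R - k%:R :> R.
Proof.
move=> ka; rewrite -natr_sum -natrB//; congr _%:R.
rewrite -(big_mkord xpredT (fun i => (k <= i)%N : nat)) (big_cat_nat (leq0n k) ka)/=.
rewrite big_nat_cond big1 ?add0n; last by move=> i /andP[/andP[_ ik] _]; rewrite leqNgt ik.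
rewrite (eq_big_nat _ _ (F2 := fun=> 1%N)); last by move=> i /andP[->].
by rewrite sum_nat_const_nat muln1.
Qed.

(** The profile 0 below [k], [al] at [k] and [be] beyond, written with step functions because their
    sums over [minn i j] are values of [dpt]. *)
Definition two_level (k : nat) (al be : R) (t : nat) : R :=
  al * (k <= t)%:R + (be - al) * (k < t)%:R.

Lemma sum_two_level n k (al be : R) : (k < n)%N ->
  \sum_(t < n) (1 - two_level k al be t) =
  n%:R - al * (n%:R - k%:R) - (be - al) * (n%:R - k.+1%:R).
Proof.
move=> kn; rewrite sumrB sumr_const card_ord big_split/= -!mulr_sumr.
by rewrite !sum_leq_ord ?(ltnW kn)//; ring.
Qed.

(** The pairs with [m <= minn i j] form a rectangle of sides [a - m] and [b - m]. *)
Lemma sum_two_level_min a b k (al be : R) : (k < a)%N -> (k < b)%N ->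
  \sum_(i < a) \sum_(j < b) two_level k al be (minn i j) =
  al * dpt a b k%:R + (be - al) * dpt a b (k%:R + 1).
Proof.
move=> ka kb.
have E m : (m <= a)%N -> (m <= b)%N ->
    \sum_(i < a) \sum_(j < b) (m <= minn i j)%:R = dpt a b m%:R :> R.
  move=> ma mb; rewrite /dpt -!sum_leq_ord// big_distrlr/=.
  by apply: eq_bigr => i _; apply: eq_bigr => j _; rewrite leq_min -mulnb natrM.
rewrite natr1 -!E ?(ltnW ka) ?(ltnW kb)// !mulr_sumr -big_split/=.
by apply: eq_bigr => i _; rewrite !mulr_sumr -big_split.
Qed.

Lemma two_level_bounds k (al be : R) t : 0 <= al <= be -> 0 <= two_level k al be t <= be.
Proof.
rewrite /two_level => /andP[a0 ab]; case: (ltnP k t) => kt.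
  by rewrite (ltnW kt) !mulr1; lra.
by case: leqP => _; rewrite !(mulr1, mulr0); lra.
Qed.

(** Passage to the limit: a critical profile meets the strict rate condition only after a shift by
    [eta], which changes the exponent linearly. *)
Lemma le_of_forall_small (d V X eta0 : R) : 0 < eta0 ->
  (forall eta, 0 < eta < eta0 -> d <= V + eta * X) -> d <= V.
Proof.
move=> e0 h; rewrite leNgt; apply/negP => Vd.
pose eta := Num.min (eta0 / 2) ((d - V) / (2 * (`|X| + 1))).
have X1 : 0 < 2 * (`|X| + 1) by rewrite mulr_gt0// ltr_pwDr.
have et0 : 0 < eta by rewrite lt_min !divr_gt0// subr_gt0.
have et1 : eta <= eta0 / 2 by rewrite ge_min lexx.
have et2 : eta <= (d - V) / (2 * (`|X| + 1)) by rewrite ge_min lexx orbT.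
have := h eta; rewrite et0 => /(_ _)/wrap[]; first by rewrite /=; lra.
rewrite ler_pdivlMr// in et2.
have : eta * X <= eta * (`|X| + 1).
  by rewrite ler_pM2l// (le_trans (ler_norm _))// lerDl.
lra.
Qed.

End Exponent.

(** * The piecewise linear outer bound *)

Unset Implicit Arguments.

Theorem theorem4 (R : realType)
  (N1r N2r N1t N2t : nat) (W1r W2r W1t W2t delta : R)
  (Ur : 'M[R[i]]_(N1r * N2r)) (lr : 'I_(N1r * N2r) -> R)
  (Ut : 'M[R[i]]_(N1t * N2t)) (lt : 'I_(N1t * N2t) -> R)
  (d0 : measure_display) (T : measurableType d0) (P : probability T R)
  (G : T -> 'M[R[i]]_(N1r * N2r, N1t * N2t))
  (nr nt Np : nat)
  (selr : R -> 'M[R[i]]_(N1r * N2r, N1t * N2t) -> 'I_nr -> 'I_(N1r * N2r))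
  (selt : R -> 'M[R[i]]_(N1r * N2r, N1t * N2t) -> 'I_nt -> 'I_(N1t * N2t))
  (K : R -> 'M[R[i]]_(N1r * N2r, N1t * N2t) -> 'M[R[i]]_nt)
  (r d : R) :
  0 < W1r -> 0 < W2r -> 0 < W1t -> 0 < W2t -> 0 < delta ->
  (0 < nr)%N -> (0 < nt)%N ->
  is_eigendecomp (corr_mx N1r N2r W1r W2r) Ur lr ->
  is_eigendecomp (corr_mx N1t N2t W1t W2t) Ut lt ->
  iid_CN P G ->
  is_Nprime R (\rank (corr_mx N1r N2r W1r W2r)) (\rank (corr_mx N1t N2t W1t W2t))
            (minn nr nt) Np ->
  (forall snr Hm, 0 < snr ->
     [/\ injective (selr snr Hm), injective (selt snr Hm) & input_cov snr (K snr Hm)]) ->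
  0 <= r <= (minn nr nt)%:R ->
  (forall snr, 0 < snr ->
     measurable (outage_event (fun w => channel delta Ur lr Ut lt (G w))
                              selr selt K snr r)) ->
  ln (fine (P (outage_event (fun w => channel delta Ur lr Ut lt (G w))
                            selr selt K snr r))) / ln snr
     @[snr --> +oo] --> - d ->
  d <= dmt_outer (\rank (corr_mx N1r N2r W1r W2r)) (\rank (corr_mx N1t N2t W1t W2t))
                 (minn nr nt) Np r.
Proof.
move=> W1r0 W2r0 W1t0 W2t0 _ _ _ _ _ Giid [Npn _] scheme /andP[r0 rn] mO lim.
rewrite !rank_corr_mx//.
set a := (N1r * N2r)%N in Ur lr G selr selt K Giid scheme mO lim *.
set b := (N1t * N2t)%N in Ut lt G selr selt K Giid scheme mO lim *.
set n := minn nr nt in Npn rn *.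
have Kcov snr Hm : 0 < snr -> input_cov snr (K snr Hm) by move=> snr0; have [] := scheme snr Hm snr0.
(* Distinctness of the selected ports, at any one SNR and channel, bounds [n] by both port
   numbers. *)
have [ir it _] := scheme 1 0 ltr01.
have na : (n <= a)%N.
  by rewrite (leq_trans (geq_minl _ _))//; have := leq_card _ ir; rewrite !card_ord.
have nb : (n <= b)%N.
  by rewrite (leq_trans (geq_minr _ _))//; have := leq_card _ it; rewrite !card_ord.
(* Two-level profiles give every edge: [al = be] the last segment, ending at [(n, 0)], and [be = 1]
   the earlier ones. *)
have main k al be : (k < n)%N -> 0 <= al <= be -> be <= 1 ->
    n%:R - al * (n%:R - k%:R) - (be - al) * (n%:R - k.+1%:R) < r ->
    d <= al * dpt a b k%:R + (be - al) * dpt a b (k%:R + 1).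
  move=> kn hal hbe hr.
  rewrite -sum_two_level_min ?(leq_trans kn)//.
  apply: (outage_exponent_le na nb Giid Kcov mO lim (beta := be)) => //.
  - by move=> t; exact: two_level_bounds.
  - move=> t nt'; have kt : (k < t)%N by apply: leq_trans nt'.
    by rewrite /two_level kt (ltnW kt) !mulr1; ring.
  - by rewrite sum_two_level.
rewrite /dmt_outer; case: (leP r Np%:R) => rNp; last first.
  have nNp : 0 < n%:R - Np%:R :> R by rewrite subr_gt0 ltr_nat.
  (* The level on indices from [Np] to [n - 1] at which the rate exponent is exactly [r]; the shift
     by [eta] brings it below [r]. *)
  pose al0 := (n%:R - r) / (n%:R - Np%:R).
  have al0E : al0 * (n%:R - Np%:R) = n%:R - r by rewrite divfK// gt_eqF.
  have al00 : 0 <= al0 by rewrite divr_ge0 ?(ltW nNp)// subr_ge0.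
  have al01 : al0 < 1 by rewrite ltr_pdivrMr// mul1r ltrD2l ltrN2.
  apply: (@le_of_forall_small _ _ _ (dpt a b Np%:R) (1 - al0)); first by rewrite subr_gt0.
  move=> eta /andP[eta0 eta1].
  have h1 : 0 <= al0 + eta <= al0 + eta by lra.
  have h2 : al0 + eta <= 1 by lra.
  have := main Np (al0 + eta) (al0 + eta) Npn h1 h2; rewrite subrr !mul0r addr0 subr0.
  have h3 : n%:R - (al0 + eta) * (n%:R - Np%:R) < r.
    have aux (x y z : R) : 0 < z -> x - (x - y + z) < y by move=> ?; lra.
    by rewrite [_ * (n%:R - Np%:R)]mulrDl al0E; apply: aux; exact: mulr_gt0.
  move=> /(_ h3) h; apply: le_trans h _.
  by rewrite mulrDl /al0 mulrAC [dpt _ _ _ * _]mulrC.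
have dpt0 : 0 <= dpt a b (0 : R) by rewrite /dpt !subr0 mulr_ge0.
(* At [r = 0] no outage occurs, and since [ln 0] is 0 the limit forces [d = 0]. *)
have [rE|rneq] := eqVneq r 0.
  suff -> : d = 0.
    by rewrite rE floor0 /= mulr0z subrr mul0r addr0 add0r subr0 mul1r.
  apply/eqP; rewrite -oppr_eq0; apply/eqP.
  have lim0 : ln (fine (P (outage_event (fun w => channel delta Ur lr Ut lt (G w))
      selr selt K snr r))) / ln snr @[snr --> +oo] --> (0 : R); last exact: cvg_unique lim lim0.
  apply: cvg_near_cst; near=> snr.
  have snr0 : 0 < snr by near: snr; exact: nbhs_pinfty_gt.
  suff -> : outage_event (fun w => channel delta Ur lr Ut lt (G w)) selr selt K snr r = set0.
    by rewrite measure0 /= ln0// mul0r.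
  rewrite -subset0 => w; rewrite /outage_event /= rE mul0r ltNge.
  by rewrite (rate_ge0 _ (Kcov _ _ snr0)).
have rpos : 0 < r by rewrite lt_neqAle eq_sym rneq.
(* At an integer [r] this [k] is one less than the floor: the edge to the left is used, so that
   [k < Np]. Both edges give the same value there. *)
have [k /andP[kr rk]] : exists k : nat, (k%:R < r) && (r <= k%:R + 1).
  have /andP[t1 t2] := truncn_itv r0.
  have [rt|rt] := eqVneq r (Num.truncn r)%:R.
    have : (0 < Num.truncn r)%N by rewrite -(ltr_nat R) -rt.
    move: rt; case: (Num.truncn r) => // k rt _; exists k.
    by rewrite rt -natr1; lra.
  by exists (Num.truncn r); rewrite lt_neqAle eq_sym rt t1/= natr1 ltW.
have kNp : (k < Np)%N by rewrite -(ltr_nat R); apply: lt_le_trans rNp.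
rewrite /=.
have -> : ((Num.floor r)%:~R + 1 - r) * dpt a b (Num.floor r)%:~R +
    (r - (Num.floor r)%:~R) * dpt a b ((Num.floor r)%:~R + 1) =
    (k%:R + 1 - r) * dpt a b k%:R + (r - k%:R) * dpt a b (k%:R + 1).
  move: rk; rewrite le_eqVlt => /predU1P[rk|rk].
    have -> : Num.floor r = k.+1%:Z.
      by apply: floor_def; rewrite rk natr1 intrD -!pmulrn lexx ltrDl ltr01.
    by rewrite rk -pmulrn -natr1 /dpt; ring.
  have -> // : Num.floor r = k%:Z.
  by apply: floor_def; rewrite intrD -!pmulrn (ltW kr).
apply: (@le_of_forall_small _ _ _ (dpt a b k%:R - dpt a b (k%:R + 1)) (r - k%:R)).
  by rewrite subr_gt0.
move=> eta /andP[eta0 eta1].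
have kn : (k < n)%N by apply: ltn_trans Npn.
(* With this level at [k] and 1 beyond, the rate exponent is [r - eta]. *)
have h1 : 0 <= k%:R + 1 - r + eta <= 1 by lra.
apply: le_trans (main k (k%:R + 1 - r + eta) 1 kn h1 (lexx 1) _) _.
  rewrite -natr1.
  have -> : n%:R - (k%:R + 1 - r + eta) * (n%:R - k%:R) -
      (1 - (k%:R + 1 - r + eta)) * (n%:R - (k%:R + 1)) = r - eta by ring.
  by rewrite gtrBl.
by rewrite le_eqVlt; apply/orP; left; apply/eqP; ring.
Unshelve. all: by end_near. Qed.
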